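(* Let $F$ be a field of characteristic not two with separable closure $F^{\mathrm{sep}}$ and absolute Galois group $\Gamma$, and let $\mathbb{G}$ be an affine group superscheme over $F$. For a quasi-rational irreducible representation $V$ of $\mathbb{G}\otimes_F F^{\mathrm{sep}}$, the following conditions are equivalent: (a) $V$ admits an $F$-form (i.e. $V\cong W\otimes_F F^{\mathrm{sep}}$ for some representation $W$ of $\mathbb{G}$); (b) $V_F$ is absolutely irreducible; (c) $\beta_{V_F}=[\mathrm{End}_{\mathbb{G}}(V_F)]\in\mathrm{Br}(F)$ is trivial. Moreover, if these equivalent conditions hold, then $$\beta^{\mathrm{super}}_{V_F}\in\{(+,1,[F])\}\cup\{(-,a,[F])\in\mathrm{BW}(F): a\in F^\times/(F^\times)^2\}.$$
   Context: Representations are right supercomodules over the Hopf superalgebra of $\mathbb{G}$, homomorphisms preserve parity, $\Pi$ is parity change, ${}^\sigma V$ is base change along $\sigma\in\Gamma$. $V$ irreducible over $F^{\mathrm{sep}}$ is quasi-rational if $\mathrm{End}_{\mathbb{G}\otimes_F F^{\mathrm{sep}}}(V)=F^{\mathrm{sep}}\mathrm{id}_V$ and ${}^\sigma V\cong V$ for all $\sigma\in\Gamma$. $V_F$ is the unique irreducible representation of $\mathbb{G}$ whose base change to $F^{\mathrm{sep}}$ contains $V$. A representation is absolutely irreducible if its base change to every field extension is irreducible. $\beta^{\mathrm{super}}_{V_F}\in\mathrm{BW}(F)$ is the class of the central division superalgebra $\underline{\mathrm{End}}_{\mathbb{G}}(V_F)=\mathrm{End}_{\mathbb{G}}(V_F)\oplus\mathrm{Hom}_{\mathbb{G}}(V_F,\Pi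 V_F)$ in the Brauer–Wall group (similarity classes of central simple superalgebras). One uses the bijection $\mathrm{BW}(F)\cong\{+,-\}\times F^\times/(F^\times)^2\times\mathrm{Br}(F)$: $A\mapsto(+,u^2,[A])$ if $A$ is central simple as an ungraded algebra, where the center of $A_{\bar0}$ is $F\oplus Fu$ with $u^2\in F^\times$ if $A_{\bar1}\ne0$, and $u=1$ if $A_{\bar 1}=0$; otherwise $A\mapsto(-,u^2,[A_{\bar0}])$, where $u$ is a nonzero odd element centralizing $A_{\bar0}$ (then $u^2\in F^\times$). *)

(* Defs.v *)
From HB Require Import structures.
From mathcomp Require Import all_boot all_algebra separable boolp.
Set Implicit Arguments.
Unset Strict Implicit.
Unset Printing Implicit Defensive.
Import GRing.Theory.
Local Open Scope ring_scope.
Local Open Scope quotient_scope.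

Section Tensor.
Variables (F : fieldType) (V W : lmodType F).

Inductive tensor_rel : seq (V * W) -> seq (V * W) -> Prop :=
| tensor_refl s : tensor_rel s s
| tensor_sym s t : tensor_rel s t -> tensor_rel t s
| tensor_trans s t u : tensor_rel s t -> tensor_rel t u -> tensor_rel s u
| tensor_cat s s' t t' :
    tensor_rel s s' -> tensor_rel t t' -> tensor_rel (s ++ t) (s' ++ t')
| tensor_catC s t : tensor_rel (s ++ t) (t ++ s)
| tensor_0l w : tensor_rel [:: (0, w)] [::]
| tensor_Dl v v' w : tensor_rel [:: (v + v', w)] [:: (v, w); (v', w)]
| tensor_Dr v w w' : tensor_rel [:: (v, w + w')] [:: (v, w); (v, w')]
| tensor_Z a v w : tensor_rel [:: (a *: v, w)] [:: (v, a *: w)].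

Definition tensor_relb s t : bool := `[< tensor_rel s t >].

Lemma tensor_relb_equiv : equiv_class_of tensor_relb.
Proof.
split=> [s|s t|t s u].
- exact/asboolP/tensor_refl.
- by apply/idP/idP => /asboolP/tensor_sym/asboolP.
- by move=> /asboolP st /asboolP tu; apply/asboolP/(tensor_trans st).
Qed.

Canonical tensor_equiv := EquivRelPack tensor_relb_equiv.

Definition tensor := {eq_quot tensor_equiv}.
HB.instance Definition _ := Choice.on tensor.
HB.instance Definition _ := EqQuotient.on tensor.

Definition tclass (s : seq (V * W)) : tensor := \pi_tensor s.

Lemma tclassP s t : tclass s = tclass t <-> tensor_rel s t.
Proof.
rewrite /tclass; split => [/eqquotP/asboolP //|r].
by apply/eqquotP/asboolP.
Qed.

Lemma tclass_repr (x : tensor) : tclass (repr x) = x.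
Proof. exact: reprK. Qed.

Lemma repr_tclass s : tensor_rel (repr (tclass s)) s.
Proof. by apply/tclassP; rewrite tclass_repr. Qed.

Definition tens (v : V) (w : W) : tensor := tclass [:: (v, w)].

Lemma tensor_0r v : tensor_rel [:: (v, 0)] [::].
Proof.
apply: tensor_trans (tensor_0l 0); apply: tensor_sym.
by have := tensor_Z 0 v 0; rewrite !scale0r.
Qed.

Definition tadd (x y : tensor) : tensor := tclass (repr x ++ repr y).
Definition tscale (a : F) (x : tensor) : tensor :=
  tclass [seq (a *: p.1, p.2) | p <- repr x].

Lemma taddE s t : tadd (tclass s) (tclass t) = tclass (s ++ t).
Proof. by apply/tclassP/tensor_cat; apply: repr_tclass. Qed.

Lemma tensor_rel_scale a s t : tensor_rel s t ->
  tensor_rel [seq (a *: p.1, p.2) | p <- s] [seq (a *: p.1, p.2) | p <- t].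
Proof.
elim=> [{}s|{}s {}t _ /tensor_sym //|{}s {}t u _ + _|||w|v v' w|v w w'|b v w] /=.
- exact: tensor_refl.
- exact: tensor_trans.
- by move=> s1 s2 t1 t2 _ r1 _ r2; rewrite !map_cat; apply: tensor_cat.
- by move=> s1 s2; rewrite !map_cat; apply: tensor_catC.
- by rewrite scaler0; apply: tensor_0l.
- by rewrite scalerDr; apply: tensor_Dl.
- exact: tensor_Dr.
- by rewrite scalerA mulrC -scalerA; apply: tensor_Z.
Qed.

Lemma tscaleE a s : tscale a (tclass s) = tclass [seq (a *: p.1, p.2) | p <- s].
Proof. exact/tclassP/tensor_rel_scale/repr_tclass. Qed.

Lemma tclass_cons v w s : tclass ((v, w) :: s) = tadd (tens v w) (tclass s).
Proof. by rewrite taddE. Qed.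

Lemma taddA : associative tadd.
Proof.
move=> x y z; rewrite -[x]tclass_repr -[y]tclass_repr -[z]tclass_repr.
by rewrite !taddE catA.
Qed.
Lemma taddC : commutative tadd.
Proof.
move=> x y; rewrite -[x]tclass_repr -[y]tclass_repr !taddE.
exact/tclassP/tensor_catC.
Qed.
Lemma tadd0 : left_id (tclass [::]) tadd.
Proof. by move=> x; rewrite -[x]tclass_repr taddE. Qed.

Lemma tscale0_class s : tclass [seq ((0 : F) *: p.1, p.2) | p <- s] = tclass [::].
Proof.
elim: s => //= -[v w] s IHs.
rewrite tclass_cons IHs taddE cats0 scale0r; exact/tclassP/tensor_0l.
Qed.

Lemma tscaleDl_class a b s :
  tclass [seq ((a + b : F) *: p.1, p.2) | p <- s] =
  tadd (tclass [seq (a *: p.1, p.2) | p <- s])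
       (tclass [seq (b *: p.1, p.2) | p <- s]).
Proof.
elim: s => [|[v w] s IHs] /=; first by rewrite taddE.
rewrite !tclass_cons IHs scalerDl.
have -> : tens (a *: v + b *: v) w = tadd (tens (a *: v) w) (tens (b *: v) w).
  by rewrite taddE; apply/tclassP/tensor_Dl.
rewrite -!taddA; congr tadd; rewrite !taddA; congr tadd; exact: taddC.
Qed.

Lemma taddN : left_inverse (tclass [::]) (tscale (-1)) tadd.
Proof.
move=> x; rewrite -[x]tclass_repr tscaleE.
rewrite -[X in tadd _ X](_ : tclass [seq (1 *: p.1, p.2) | p <- repr x] = _).
  by rewrite -tscaleDl_class addNr tscale0_class.
by congr tclass; rewrite -[RHS]map_id; apply: eq_map => -[v w] /=; rewrite scale1r.
Qed.

HB.instance Definition _ :=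
  GRing.isZmodule.Build tensor taddA taddC tadd0 taddN.

Lemma tclassD s t : tclass (s ++ t) = tclass s + tclass t.
Proof. by rewrite -taddE. Qed.

Lemma tclass_sum s : tclass s = \sum_(p <- s) tens p.1 p.2.
Proof.
elim: s => [|p s IHs]; first by rewrite big_nil.
by rewrite big_cons -IHs -cat1s tclassD; case: p.
Qed.

Lemma tensE (x : tensor) : x = \sum_(p <- repr x) tens p.1 p.2.
Proof. by rewrite -tclass_sum tclass_repr. Qed.

Lemma tscaleA a b x : tscale a (tscale b x) = tscale (a * b) x.
Proof.
rewrite -[x]tclass_repr !tscaleE -map_comp; congr tclass.
by apply: eq_map => p /=; rewrite scalerA.
Qed.
Lemma tscale1 : left_id 1 tscale.
Proof.
move=> x; rewrite -[x]tclass_repr tscaleE; congr tclass.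
by rewrite -[RHS]map_id; apply: eq_map => -[v w] /=; rewrite scale1r.
Qed.
Lemma tscaleDr : right_distributive tscale +%R.
Proof.
move=> a x y; rewrite -[x]tclass_repr -[y]tclass_repr -tclassD !tscaleE.
by rewrite map_cat tclassD.
Qed.
Lemma tscaleDl v : {morph tscale^~ v : a b / a + b}.
Proof. by move=> a b; rewrite -[v]tclass_repr !tscaleE tscaleDl_class. Qed.

HB.instance Definition _ :=
  GRing.Zmodule_isLmodule.Build F tensor tscaleA tscale1 tscaleDr tscaleDl.

Lemma tensDl v v' w : tens (v + v') w = tens v w + tens v' w.
Proof. by rewrite -tclassD; apply/tclassP/tensor_Dl. Qed.
Lemma tensDr v w w' : tens v (w + w') = tens v w + tens v w'.
Proof. by rewrite -tclassD; apply/tclassP/tensor_Dr. Qed.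
Lemma tensZl a v w : tens (a *: v) w = a *: tens v w.
Proof. by rewrite [RHS]tscaleE. Qed.
Lemma tensZr a v w : tens v (a *: w) = a *: tens v w.
Proof. by rewrite -tensZl; apply/tclassP/tensor_sym/tensor_Z. Qed.

Lemma tensor_ind (P : tensor -> Prop) :
  P 0 -> (forall x y, P x -> P y -> P (x + y)) -> (forall v w, P (tens v w)) ->
  forall x, P x.
Proof.
by move=> P0 PD Pt x; rewrite [x]tensE; elim/big_ind: _ => // p _; apply: Pt.
Qed.

Lemma tensor_ext (U : zmodType) (f g : {additive tensor -> U}) :
  (forall v w, f (tens v w) = g (tens v w)) -> f =1 g.
Proof.
by move=> fg; elim/tensor_ind => [|x y fx fy|//]; rewrite ?raddf0 ?raddfD ?fx ?fy.
Qed.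

Definition balanced (U : zmodType) (f : V -> W -> U) : Prop :=
  [/\ forall v v' w, f (v + v') w = f v w + f v' w,
      forall v w w', f v (w + w') = f v w + f v w'
    & forall a v w, f (a *: v) w = f v (a *: w)].

(* The extension of f along tens; it is meaningful for balanced f only,
   being computed on an arbitrary representative. *)
Definition tlift (U : zmodType) (f : V -> W -> U) (x : tensor) : U :=
  \sum_(p <- repr x) f p.1 p.2.

Lemma tlift_class (U : zmodType) (f : V -> W -> U) s :
  balanced f -> tlift f (tclass s) = \sum_(p <- s) f p.1 p.2.
Proof.
case=> fDl fDr fZ; rewrite /tlift.
have f0l w : f 0 w = 0 by apply: (addrI (f 0 w)); rewrite -fDl !addr0.
suff fE s' t : tensor_rel s' t ->
    \sum_(p <- s') f p.1 p.2 = \sum_(p <- t) f p.1 p.2.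
  exact/fE/repr_tclass.
elim=> {s' t} [//|s1 t1 _ -> //|s1 t1 u1 _ -> _ -> //
       |s1 s2 t1 t2 _ r1 _ r2|s1 t1|w|v v' w|v w w'|a v w];
  rewrite ?big_cat ?big_seq1 ?big_nil ?big_cons ?big_nil ?addr0 //=.
- by rewrite r1 r2.
- exact: addrC.
Qed.

Lemma tliftE (U : zmodType) (f : V -> W -> U) v w :
  balanced f -> tlift f (tens v w) = f v w.
Proof. by move=> fb; rewrite tlift_class // big_seq1. Qed.

Lemma tliftD (U : zmodType) (f : V -> W -> U) :
  balanced f -> {morph tlift f : x y / x + y}.
Proof.
move=> fb x y; rewrite -[x]tclass_repr -[y]tclass_repr -tclassD.
by rewrite !tlift_class // big_cat.
Qed.

Lemma tlift0 (U : zmodType) (f : V -> W -> U) : balanced f -> tlift f 0 = 0.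
Proof. by move=> fb; apply: (addrI (tlift f 0)); rewrite -tliftD // !addr0. Qed.

End Tensor.

Definition semilinear (F K : fieldType) (j : {rmorphism F -> K})
    (V : lmodType F) (W : lmodType K) (f : V -> W) : Prop :=
  (forall u v, f (u + v) = f u + f v) /\ (forall a v, f (a *: v) = j a *: f v).

Section Semilinear.
Variables (F K L : fieldType) (j : {rmorphism F -> K}) (i : {rmorphism K -> L}).
Variables (U : lmodType F) (V : lmodType K) (W : lmodType L).

Lemma linear_semi (U' : lmodType F) (f : U -> U') :
  linear f <-> semilinear idfun f.
Proof.
split=> [fL|[fD fZ] a u v]; last by rewrite fD fZ.
have fD u v : f (u + v) = f u + f v by have := fL 1 u v; rewrite !scale1r.
split=> // a v; have := fL a v 0; rewrite addr0 => ->.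
suff -> : f 0 = 0 by rewrite addr0.
by apply: (addrI (f 0)); rewrite -fD !addr0.
Qed.

Lemma semi_id : semilinear idfun (fun u : U => u).
Proof. by []. Qed.

Lemma semi_comp (f : U -> V) (g : V -> W) :
  semilinear j f -> semilinear i g -> semilinear (i \o j) (g \o f).
Proof. by case=> fD fZ [gD gZ]; split=> [u v|a v] /=; rewrite ?fD ?fZ ?gD ?gZ. Qed.

Lemma semi_comp_l (f : U -> V) (g : V -> V) :
  semilinear j f -> semilinear idfun g -> semilinear j (g \o f).
Proof. by case=> fD fZ [gD gZ]; split=> [u v|a v] /=; rewrite ?fD ?fZ ?gD ?gZ. Qed.

Lemma semi_add (f g : U -> V) :
  semilinear j f -> semilinear j g -> semilinear j (fun u => f u + g u).
Proof.
case=> fD fZ [gD gZ]; split=> [u v|a v]; rewrite ?fD ?gD ?fZ ?gZ ?scalerDr //.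
exact: addrACA.
Qed.

Lemma semi0 (f : U -> V) : semilinear j f -> f 0 = 0.
Proof. by case=> fD _; apply: (addrI (f 0)); rewrite -fD !addr0. Qed.

Lemma semi_sum (f : U -> V) (I : Type) (r : seq I) (G : I -> U) :
  semilinear j f -> f (\sum_(x <- r) G x) = \sum_(x <- r) f (G x).
Proof. by move=> fs; apply: (big_morph f (proj1 fs) (semi0 fs)). Qed.

End Semilinear.

Section TensorMaps.
Variables (F K : fieldType) (j : {rmorphism F -> K}).

Definition tmap (V W : lmodType F) (V' W' : lmodType K)
    (f : V -> V') (g : W -> W') : tensor V W -> tensor V' W' :=
  tlift (fun v w => tens (f v) (g w)).

Lemma tens_bal (V W : lmodType F) (V' W' : lmodType K)
    (f : V -> V') (g : W -> W') :
  semilinear j f -> semilinear j g -> balanced (fun v w => tens (f v) (g w)).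
Proof.
case=> fD fZ [gD gZ]; split=> *.
- by rewrite fD tensDl.
- by rewrite gD tensDr.
- by rewrite fZ gZ tensZl tensZr.
Qed.

Lemma tmapE (V W : lmodType F) (V' W' : lmodType K)
    (f : V -> V') (g : W -> W') v w :
  semilinear j f -> semilinear j g -> tmap f g (tens v w) = tens (f v) (g w).
Proof. by move=> fs gs; rewrite /tmap tliftE //; apply: tens_bal. Qed.

Lemma tlift_semi (V W : lmodType F) (U : lmodType K) (f : V -> W -> U) :
  (forall w, semilinear j (f^~ w)) -> (forall v, semilinear j (f v)) ->
  balanced f /\ semilinear j (tlift f).
Proof.
move=> fl fr; have fb : balanced f.
  split=> [v v' w|v w w'|a v w]; first exact: (proj1 (fl w)).
    exact: (proj1 (fr v)).
  by rewrite (proj2 (fl w)) (proj2 (fr v)).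
split=> //; split; first exact: tliftD.
move=> a; elim/tensor_ind => [|x y xE yE|v w].
- by rewrite !(scaler0, tlift0).
- by rewrite scalerDr !tliftD // xE yE scalerDr.
- by rewrite -tensZl !tliftE // (proj2 (fl w)).
Qed.

Lemma tmap_semi (V W : lmodType F) (V' W' : lmodType K)
    (f : V -> V') (g : W -> W') :
  semilinear j f -> semilinear j g -> semilinear j (tmap f g).
Proof.
case=> fD fZ [gD gZ]; have [] // := @tlift_semi _ _ _ (fun v w => tens (f v) (g w)).
- by move=> w; split=> *; rewrite ?fD ?fZ ?tensDl ?tensZl.
- by move=> v; split=> *; rewrite ?gD ?gZ ?tensDr ?tensZr.
Qed.

Lemma tensor_eq (V W : lmodType F) (U : lmodType K) (f g : tensor V W -> U) :
  semilinear j f -> semilinear j g ->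
  (forall v w, f (tens v w) = g (tens v w)) -> f =1 g.
Proof.
move=> fs gs fg; elim/tensor_ind => [|x y fx fy|//].
  by rewrite (semi0 fs) (semi0 gs).
by rewrite (proj1 fs) (proj1 gs) fx fy.
Qed.

End TensorMaps.

Section Assoc.
Variables (F : fieldType) (U V W : lmodType F).

Definition tassoc : tensor (tensor U V) W -> tensor U (tensor V W) :=
  tlift (fun x w => tlift (fun u v => tens u (tens v w)) x).

Lemma tassoc_inner (w : W) :
  balanced (fun (u : U) (v : V) => tens u (tens v w)) /\
  semilinear idfun (tlift (fun (u : U) (v : V) => tens u (tens v w))).
Proof.
apply: tlift_semi => x; split=> *;
  by rewrite ?tensDl ?tensZl ?tensDr ?tensZr.
Qed.

Lemma tassoc_outer :
  balanced (fun (x : tensor U V) (w : W) => tlift (fun u v => tens u (tens v w)) x) /\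
  semilinear idfun tassoc.
Proof.
apply: tlift_semi => [w|x]; first exact: (proj2 (tassoc_inner w)).
have tb w := proj1 (tassoc_inner w).
split=> [w w'|a w]; elim/tensor_ind: x => [|x y xE yE|u v].
- by rewrite !tlift0 ?addr0; try exact: tb.
- rewrite (tliftD (tb _)) xE yE (tliftD (tb w)) (tliftD (tb w')); exact: addrACA.
- by rewrite (tliftE _ _ (tb _)) (tliftE _ _ (tb w)) (tliftE _ _ (tb w')) !tensDr.
- by rewrite !tlift0 ?scaler0; try exact: tb.
- by rewrite (tliftD (tb _)) xE yE (tliftD (tb w)) scalerDr.
- by rewrite (tliftE _ _ (tb _)) (tliftE _ _ (tb w)) !tensZr.
Qed.

Lemma tassoc_semi : semilinear idfun tassoc.
Proof. exact: (proj2 tassoc_outer). Qed.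

Lemma tassocE u v w : tassoc (tens (tens u v) w) = tens u (tens v w).
Proof.
rewrite /tassoc (tliftE _ _ (proj1 tassoc_outer)).
exact: (tliftE _ _ (proj1 (tassoc_inner w))).
Qed.

End Assoc.

Lemma tensor3_eq (F K : fieldType) (j : {rmorphism F -> K})
  (U V W : lmodType F) (X : lmodType K) (f g : tensor (tensor U V) W -> X) :
  semilinear j f -> semilinear j g ->
  (forall u v w, f (tens (tens u v) w) = g (tens (tens u v) w)) -> f =1 g.
Proof.
move=> fs gs fg; apply: (tensor_eq fs gs) => x w.
elim/tensor_ind: x => [|x y xE yE|//].
- by rewrite -(scale0r 0) tensZl (proj2 fs) (proj2 gs) rmorph0 !scale0r.
- by rewrite tensDl (proj1 fs) (proj1 gs) xE yE.
Qed.

Lemma tassoc_nat (F K : fieldType) (j : {rmorphism F -> K})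
  (U V W : lmodType F) (U' V' W' : lmodType K)
  (f : U -> U') (g : V -> V') (h : W -> W') :
  semilinear j f -> semilinear j g -> semilinear j h ->
  forall x, tassoc (tmap (tmap f g) h x) = tmap f (tmap g h) (tassoc x).
Proof.
move=> fs gs hs; have fgs := tmap_semi fs gs; have ghs := tmap_semi gs hs.
apply: (@tensor3_eq _ _ j).
- have [tD tZ] := tassoc_semi U' V' W'; have [mD mZ] := tmap_semi fgs hs.
  by split=> *; rewrite ?mD ?mZ ?tD ?tZ.
- have [tD tZ] := tassoc_semi U V W; have [mD mZ] := tmap_semi fs ghs.
  by split=> *; rewrite ?tD ?tZ ?mD ?mZ.
- by move=> u v w; rewrite !(tmapE _ _ fgs, tmapE _ _ hs, tmapE _ _ fs) //
    !tassocE !(tmapE _ _ fs) // (tmapE _ _ gs).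
Qed.

Section SemiMore.
Variables (F K : fieldType) (j : {rmorphism F -> K}).

Lemma semi_comp_l' (U V : lmodType F) (W : lmodType K) (f : U -> V) (g : V -> W) :
  semilinear idfun f -> semilinear j g -> semilinear j (fun x => g (f x)).
Proof. by case=> fD fZ [gD gZ]; split=> [u v|a v] /=; rewrite ?fD ?fZ ?gD ?gZ. Qed.

Lemma tmap_square (V W V1 W1 : lmodType F) (V' W' V1' W1' : lmodType K)
    (f : V -> V1) (g : W -> W1) (f' : V' -> V1') (g' : W' -> W1')
    (p : V -> V') (q : W -> W') (p1 : V1 -> V1') (q1 : W1 -> W1') x :
  semilinear idfun f -> semilinear idfun g ->
  semilinear idfun f' -> semilinear idfun g' ->
  semilinear j p -> semilinear j q -> semilinear j p1 -> semilinear j q1 ->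
  (forall v, f' (p v) = p1 (f v)) -> (forall w, g' (q w) = q1 (g w)) ->
  tmap f' g' (tmap p q x) = tmap p1 q1 (tmap f g x).
Proof.
move=> fs gs fs' gs' ps qs ps1 qs1 fp gq.
have [D1 Z1] := tmap_semi ps qs; have [D1' Z1'] := tmap_semi fs' gs'.
have [D2 Z2] := tmap_semi fs gs; have [D2' Z2'] := tmap_semi ps1 qs1.
have ls : semilinear j (fun x => tmap f' g' (tmap p q x)).
  by split=> *; rewrite ?D1 ?Z1 ?D1' ?Z1'.
have rs : semilinear j (fun x => tmap p1 q1 (tmap f g x)).
  by split=> *; rewrite ?D2 ?Z2 ?D2' ?Z2'.
apply: (tensor_eq ls rs) => v w.
rewrite (tmapE _ _ ps qs) (tmapE _ _ fs' gs') (tmapE _ _ fs gs).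
by rewrite (tmapE _ _ ps1 qs1) fp gq.
Qed.
End SemiMore.

HB.mixin Record Lmodule_isSuper (F : fieldType) V of GRing.Lmodule F V := {
  spart : bool -> V -> V;
  spart_linear : forall b, linear (spart b);
  spartK : forall b c v, spart b (spart c v) = if b == c then spart c v else 0;
  spart_sum : forall v, spart false v + spart true v = v
}.
#[short(type="superModType")]
HB.structure Definition SuperModule (F : fieldType) :=
  {V of Lmodule_isSuper F V & GRing.Lmodule F V}.

Definition homog (F : fieldType) (V : superModType F) (b : bool) (v : V) : Prop :=
  spart b v = v.

Section SuperTensor.
Variables (F : fieldType) (V W : superModType F).

Lemma spart_semi (U : superModType F) b : semilinear idfun (@spart F U b).
Proof. exact/linear_semi/spart_linear. Qed.

Definition tpart (b : bool) (x : tensor V W) : tensor V W :=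
  tmap (spart false) (spart b) x + tmap (spart true) (spart (~~ b)) x.

Lemma tpart_semi b : semilinear idfun (tpart b).
Proof. by apply: semi_add; apply: tmap_semi; apply: spart_semi. Qed.

Lemma tpart_tens b v w :
  tpart b (tens v w) = tens (spart false v) (spart b w)
                     + tens (spart true v) (spart (~~ b) w).
Proof. by rewrite /tpart !(tmapE _ _ (spart_semi _ _)) //; apply: spart_semi. Qed.

Lemma tens0l (v : W) : tens (0 : V) v = 0.
Proof. by rewrite -(scale0r 0) tensZl scale0r. Qed.
Lemma tens0r (v : V) : tens v (0 : W) = 0.
Proof. by rewrite -(scale0r 0) tensZr scale0r. Qed.

Lemma tpart_linear b : linear (tpart b).
Proof. exact/linear_semi/tpart_semi. Qed.

Lemma tpartK b c x : tpart b (tpart c x) = if b == c then tpart c x else 0.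
Proof.
have cs := tpart_semi c; have bs := tpart_semi b.
have bcs : semilinear idfun (fun x => tpart b (tpart c x)) := semi_comp_l cs bs.
have ifs : semilinear idfun (fun x => if b == c then tpart c x else 0).
  by case: (b == c) => //; split=> *; rewrite ?addr0 ?scaler0.
apply: (tensor_eq bcs ifs).
move=> v w; rewrite tpart_tens (proj1 bs) !tpart_tens !spartK !eqxx /=.
  by case: b c {cs bs bcs ifs} => -[]; rewrite ?tens0l ?tens0r ?addr0 ?add0r.
Qed.

Lemma tpart_sum x : tpart false x + tpart true x = x.
Proof.
have cs := semi_add (tpart_semi false) (tpart_semi true).
apply: (tensor_eq cs (semi_id _)) => v w.
rewrite !tpart_tens /= addrACA -!tensDr [spart true w + _]addrC spart_sum.
by rewrite -tensDl spart_sum.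
Qed.

HB.instance Definition _ :=
  Lmodule_isSuper.Build F (tensor V W) tpart_linear tpartK tpart_sum.

End SuperTensor.

HB.mixin Record Algebra_isSuper (F : fieldType) A
    of GRing.Algebra F A & SuperModule F A := {
  homog1 : homog false (1 : A);
  homogM : forall b c (x y : A),
    homog b x -> homog c y -> homog (b (+) c) (x * y)
}.
#[short(type="superAlgType")]
HB.structure Definition SuperAlgebra (F : fieldType) :=
  {A of Algebra_isSuper F A & GRing.Algebra F A & SuperModule F A}.

(* (a (x) b)(c (x) d) = (-1)^{|b||c|} ac (x) bd on homogeneous b, c *)
Definition smul4 (F : fieldType) (A : superAlgType F) (a b c d : A) :=
  \sum_(i : bool) \sum_(k : bool)
     (-1) ^+ (i && k) *: tens (a * spart k c) (spart i b * d).

Definition tmul (F : fieldType) (A : superAlgType F) (x y : tensor A A) :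
    tensor A A :=
  tlift (fun a b => tlift (fun c d => smul4 a b c d) y) x.

(* The coordinate ring of an affine group superscheme; in characteristic not 2
   supercommute forces odd elements to square to zero. *)
HB.mixin Record SuperAlgebra_isHopf (F : fieldType) A of SuperAlgebra F A := {
  supercommute : forall b c (x y : A),
    homog b x -> homog c y -> x * y = (-1) ^+ (b && c) * (y * x);
  comul : A -> tensor A A;
  counit : A -> F;
  antipode : A -> A;
  comul_linear : linear comul;
  comul_even : forall b x, comul (spart b x) = spart b (comul x);
  comul1 : comul 1 = tens 1 1;
  comulM : forall x y, comul (x * y) = tmul (comul x) (comul y);
  counit_linear : scalar counit;
  counit_even : forall x, counit (spart true x) = 0;
  counit1 : counit 1 = 1;
  counitM : {morph counit : x y / x * y};
  antipode_linear : linear antipode;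
  antipode_even : forall b x, antipode (spart b x) = spart b (antipode x);
  comulA : forall x,
    tassoc (tmap comul (fun y : A => y) (comul x))
    = tmap (fun y : A => y) comul (comul x);
  counit_comul : forall x, tlift (fun y z => counit y *: z) (comul x) = x;
  comul_counit : forall x, tlift (fun y z => counit z *: y) (comul x) = x;
  antipode_comul : forall x,
    tlift (fun y z => antipode y * z) (comul x) = counit x *: 1;
  comul_antipode : forall x,
    tlift (fun y z => y * antipode z) (comul x) = counit x *: 1
}.
#[short(type="hopfSuperType")]
HB.structure Definition HopfSuper (F : fieldType) :=
  {A of SuperAlgebra_isHopf F A & SuperAlgebra F A}.

Lemma tpart_nat (F K : fieldType) (j : {rmorphism F -> K})
    (V W : superModType F) (V' W' : superModType K)
    (f : V -> V') (g : W -> W') b x :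
  semilinear j f -> semilinear j g ->
  (forall c v, f (spart c v) = spart c (f v)) ->
  (forall c w, g (spart c w) = spart c (g w)) ->
  tmap f g (spart b x) = spart b (tmap f g x).
Proof.
move=> fs gs fp gp; have ms := tmap_semi fs gs.
change (tmap f g (tpart b x) = tpart b (tmap f g x)).
rewrite {1}/tpart (proj1 ms); congr (_ + _);
  by apply/esym/(tmap_square (j := j)) => //; apply: spart_semi.
Qed.

(* K as an F-module along j *)
Definition restr (F K : fieldType) (j : {rmorphism F -> K}) : Type := K.

Section RestrictScalars.
Variables (F K : fieldType) (j : {rmorphism F -> K}).
Local Notation restr := (restr j).

HB.instance Definition _ := GRing.Zmodule.copy restr K.

Let rscale (a : F) (x : restr) : restr := j a * (x : K).
Let rscaleA a b x : rscale a (rscale b x) = rscale (a * b) x.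
Proof. by rewrite /rscale rmorphM mulrA. Qed.
Let rscale1 : left_id 1 rscale.
Proof. by move=> x; rewrite /rscale rmorph1 mul1r. Qed.
Let rscaleDr : right_distributive rscale +%R.
Proof. by move=> a x y; rewrite /rscale mulrDr. Qed.
Let rscaleDl x : {morph rscale^~ x : a b / a + b}.
Proof. by move=> a b; rewrite /rscale rmorphD mulrDl. Qed.
HB.instance Definition _ :=
  GRing.Zmodule_isLmodule.Build F restr rscaleA rscale1 rscaleDr rscaleDl.

Lemma restr_scaleE (a : F) (x : restr) : a *: x = (j a * (x : K) : restr).
Proof. by []. Qed.

End RestrictScalars.

Section BaseChange.
Variables (F K : fieldType) (j : {rmorphism F -> K}).

Definition bc (V : lmodType F) : Type := tensor (restr j) V.
HB.instance Definition _ (V : lmodType F) :=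
  GRing.Zmodule.copy (bc V) (tensor (restr j) V).

Section Module.
Variable V : lmodType F.

Definition bctens (k : K) (v : V) : bc V := tens (k : restr j) v.

Definition bcscale (k : K) : bc V -> bc V :=
  tlift (fun (l : restr j) v => bctens (k * (l : K)) v).

Lemma bcscale_bal k :
  balanced (fun (l : restr j) v => bctens (k * (l : K)) v).
Proof.
split=> [l l' v|l v v'|a l v]; rewrite /bctens.
- by rewrite mulrDr; apply: tensDl.
- exact: tensDr.
- by rewrite restr_scaleE mulrCA tensZr; apply: (tensZl a (k * (l : K) : restr j)).
Qed.

Lemma bcscaleE k l v : bcscale k (bctens l v) = bctens (k * l) v.
Proof. exact: tliftE (bcscale_bal k). Qed.

Lemma bcscaleDr : right_distributive bcscale +%R.
Proof. by move=> k; apply: tliftD (bcscale_bal k). Qed.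

Lemma bctens_ind (P : bc V -> Prop) :
  P 0 -> (forall x y, P x -> P y -> P (x + y)) ->
  (forall k v, P (bctens k v)) -> forall x, P x.
Proof. exact: tensor_ind. Qed.

Lemma bcscale0 k : bcscale k 0 = 0.
Proof. exact: tlift0 (bcscale_bal k). Qed.

Lemma bcscaleA k l x : bcscale k (bcscale l x) = bcscale (k * l) x.
Proof.
elim/bctens_ind: x => [|x y xE yE|m v]; first by rewrite !bcscale0.
  by rewrite !bcscaleDr xE yE.
by rewrite !bcscaleE mulrA.
Qed.
Lemma bcscale1 : left_id 1 bcscale.
Proof.
elim/bctens_ind => [|x y xE yE|m v]; first by rewrite !bcscale0.
  by rewrite !bcscaleDr xE yE.
by rewrite !bcscaleE mul1r.
Qed.
Lemma bcscaleDl x : {morph bcscale^~ x : k l / k + l}.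
Proof.
move=> k l; elim/bctens_ind: x => [|x y xE yE|m v].
- by rewrite !bcscale0 addr0.
- by rewrite !bcscaleDr xE yE addrACA.
- by rewrite !bcscaleE mulrDl; apply: tensDl.
Qed.
HB.instance Definition _ :=
  GRing.Zmodule_isLmodule.Build K (bc V) bcscaleA bcscale1 bcscaleDr bcscaleDl.

Definition bcin (v : V) : bc V := bctens 1 v.

Lemma bctensE k v : bctens k v = k *: bcin v.
Proof. by rewrite [RHS]bcscaleE mulr1. Qed.

Lemma bcin_semi : semilinear j bcin.
Proof.
split=> [v v'|a v]; first exact: tensDr.
rewrite -bctensE /bcin /bctens tensZr -tensZl.
by congr tens; rewrite restr_scaleE mulr1.
Qed.

Lemma bc_ind (P : bc V -> Prop) :
  P 0 -> (forall x y, P x -> P y -> P (x + y)) ->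
  (forall k v, P (k *: bcin v)) -> forall x, P x.
Proof. by move=> P0 PD Pk; apply: bctens_ind => // k v; rewrite bctensE. Qed.

Definition bcext (U : lmodType K) (f : V -> U) : bc V -> U :=
  tlift (fun (k : restr j) v => (k : K) *: f v).

Section Ext.
Variables (U : lmodType K) (f : V -> U).
Hypothesis fs : semilinear j f.

Lemma bcext_bal : balanced (fun (k : restr j) v => (k : K) *: f v).
Proof.
case: fs => fD fZ; split=> [k k' v|k v v'|a k v].
- by rewrite scalerDl.
- by rewrite fD scalerDr.
- by rewrite fZ scalerA restr_scaleE mulrC.
Qed.

Lemma bcext_bctens k v : bcext f (bctens k v) = k *: f v.
Proof. exact: tliftE bcext_bal. Qed.

Lemma bcextE v : bcext f (bcin v) = f v.
Proof. by rewrite bcext_bctens scale1r. Qed.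

Lemma bcext_semi : semilinear idfun (bcext f).
Proof.
have bD : {morph bcext f : x y / x + y} := tliftD bcext_bal.
split=> // k; elim/bctens_ind => [|x y xE yE|l v].
- by rewrite scaler0 [bcext f 0]tlift0 ?scaler0 //; apply: bcext_bal.
- by rewrite scalerDr !bD xE yE scalerDr.
- by rewrite [k *: bctens l v]bcscaleE !bcext_bctens scalerA.
Qed.

End Ext.

Lemma bc_eq (L : fieldType) (i : {rmorphism K -> L}) (U : lmodType L)
    (f g : bc V -> U) :
  semilinear i f -> semilinear i g ->
  (forall v, f (bcin v) = g (bcin v)) -> f =1 g.
Proof.
move=> fs gs fg; elim/bc_ind => [|x y fx fy|k v].
- by rewrite (semi0 fs) (semi0 gs).
- by rewrite (proj1 fs) (proj1 gs) fx fy.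
- by rewrite (proj2 fs) (proj2 gs) fg.
Qed.

End Module.

Section Super.
Variable V : superModType F.

Definition bcpart (b : bool) : bc V -> bc V := bcext (fun v => bcin (spart b v)).

Lemma bcin_part_semi b : semilinear j (fun v : V => bcin (spart b v)).
Proof.
have [iD iZ] := bcin_semi V; have [sD sZ] := spart_semi V b.
by split=> *; rewrite ?sD ?sZ ?iD ?iZ.
Qed.
Lemma bcpart_semi b : semilinear idfun (bcpart b).
Proof. exact: bcext_semi (bcin_part_semi b). Qed.
Lemma bcpart_in b v : bcpart b (bcin v) = bcin (spart b v).
Proof. exact: bcextE (bcin_part_semi b) v. Qed.

Lemma bcpart_linear b : linear (bcpart b).
Proof. exact/linear_semi/bcpart_semi. Qed.
Lemma bcpartK b c x : bcpart b (bcpart c x) = if b == c then bcpart c x else 0.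
Proof.
have cs := bcpart_semi c; have bs := bcpart_semi b.
have bcs : semilinear idfun (fun x => bcpart b (bcpart c x)) := semi_comp_l cs bs.
have ifs : semilinear idfun (fun x => if b == c then bcpart c x else 0).
  by case: (b == c) => //; split=> *; rewrite ?addr0 ?scaler0.
apply: (bc_eq bcs ifs) => v; rewrite !bcpart_in spartK.
by case: (b == c) => //; exact: semi0 (bcin_semi V).
Qed.
Lemma bcpart_sum x : bcpart false x + bcpart true x = x.
Proof.
have bs := semi_add (bcpart_semi false) (bcpart_semi true).
apply: (bc_eq bs (semi_id _)) => v /=.
by rewrite !bcpart_in -(proj1 (bcin_semi V)) spart_sum.
Qed.
HB.instance Definition _ :=
  Lmodule_isSuper.Build K (bc V) bcpart_linear bcpartK bcpart_sum.

Lemma bc_spart_in b v : spart b (bcin v) = bcin (spart b v).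
Proof. exact: bcpart_in. Qed.

End Super.
End BaseChange.
Arguments bcin {F K} j {V} v.

Section Bilinear.
Variables (F K : fieldType) (j : {rmorphism F -> K}).
Variables (V W : lmodType F) (U : lmodType K).

Definition bilin (f : V -> W -> U) : Prop :=
  (forall w, semilinear j (f^~ w)) /\ (forall v, semilinear j (f v)).

Lemma bilin_bal f : bilin f -> balanced f.
Proof. by case=> fl fr; case: (tlift_semi fl fr). Qed.

Lemma bilin_semi f : bilin f -> semilinear j (tlift f).
Proof. by case=> fl fr; case: (tlift_semi fl fr). Qed.

Lemma tliftEb f v w : bilin f -> tlift f (tens v w) = f v w.
Proof. by move=> fb; apply/tliftE/bilin_bal. Qed.

Lemma eq_tlift (U' : zmodType) (f g : V -> W -> U') x :
  (forall v w, f v w = g v w) -> tlift f x = tlift g x.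
Proof. by move=> fg; apply: eq_bigr. Qed.

Lemma semi_scale (U' : lmodType F) (f : U' -> U) a :
  semilinear j f -> semilinear j (fun x => a *: f x).
Proof.
case=> fD fZ; split=> [x y|b x]; first by rewrite fD scalerDr.
by rewrite fZ !scalerA mulrC.
Qed.

Lemma semi_bigsum (U' : lmodType F) (I : Type) (r : seq I) (f : I -> U' -> U) :
  (forall i, semilinear j (f i)) -> semilinear j (fun x => \sum_(i <- r) f i x).
Proof.
move=> fs; split=> [x y|a x].
  by rewrite -big_split; apply: eq_bigr => i _; apply: (proj1 (fs i)).
by rewrite scaler_sumr; apply: eq_bigr => i _; apply: (proj2 (fs i)).
Qed.
End Bilinear.

Lemma tlift_tmap (F K : fieldType) (j : {rmorphism F -> K})
    (V W : lmodType F) (V' W' U : lmodType K) (g : V -> V') (h : W -> W')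
    (f : V' -> W' -> U) x :
  semilinear j g -> semilinear j h -> bilin idfun f ->
  tlift f (tmap g h x) = tlift (fun v w => f (g v) (h w)) x.
Proof.
move=> gs hs fb.
have fghb : bilin j (fun v w => f (g v) (h w)).
  by split=> [w|v]; [have [D Z] := proj1 fb (h w); have [D' Z'] := gs
    | have [D Z] := proj2 fb (g v); have [D' Z'] := hs];
    split=> *; rewrite ?D' ?Z' ?D ?Z.
have [D Z] := bilin_semi fb; have [D' Z'] := tmap_semi gs hs.
have ls : semilinear j (fun x => tlift f (tmap g h x)).
  by split=> *; rewrite ?D' ?Z' ?D ?Z.
apply: (tensor_eq ls (bilin_semi fghb)) => v w.
by rewrite (tmapE _ _ gs hs) (tliftEb _ _ fb) (tliftEb _ _ fghb).
Qed.

Lemma semi_tlift (F K : fieldType) (j : {rmorphism F -> K})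
    (V W U : lmodType F) (U' : lmodType K) (f : V -> W -> U) (g : U -> U') x :
  bilin idfun f -> semilinear j g ->
  g (tlift f x) = tlift (fun v w => g (f v w)) x.
Proof. by move=> fb gs; rewrite /tlift (semi_sum _ _ gs). Qed.

Section TensorMul.
Variables (F : fieldType) (A : superAlgType F).

Lemma mul_semil (a : A) : semilinear idfun (fun x => a * x).
Proof. by split=> *; rewrite ?mulrDr ?scalerAr. Qed.
Lemma mul_semir (a : A) : semilinear idfun (fun x => x * a).
Proof. by split=> *; rewrite ?mulrDl ?scalerAl. Qed.
Lemma tens_semil (X V W : lmodType F) (v : V) (g : X -> W) :
  semilinear idfun g -> semilinear idfun (fun x => tens v (g x)).
Proof. by case=> D Z; split=> *; rewrite ?D ?Z ?tensDr ?tensZr. Qed.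
Lemma tens_semir (X V W : lmodType F) (w : W) (g : X -> V) :
  semilinear idfun g -> semilinear idfun (fun x => tens (g x) w).
Proof. by case=> D Z; split=> *; rewrite ?D ?Z ?tensDl ?tensZl. Qed.

Lemma smul4_semi1 (b c d : A) : semilinear idfun (fun a => smul4 a b c d).
Proof.
do 2!apply: semi_bigsum => ?; apply: semi_scale.
exact/tens_semir/mul_semir.
Qed.
Lemma smul4_semi2 (a c d : A) : semilinear idfun (fun b => smul4 a b c d).
Proof.
do 2!apply: semi_bigsum => ?; apply: semi_scale; apply: tens_semil.
exact: semi_comp_l (spart_semi _ _) (mul_semir _).
Qed.
Lemma smul4_semi3 (a b d : A) : semilinear idfun (fun c => smul4 a b c d).
Proof.
do 2!apply: semi_bigsum => ?; apply: semi_scale; apply: tens_semir.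
exact: semi_comp_l (spart_semi _ _) (mul_semil _).
Qed.
Lemma smul4_semi4 (a b c : A) : semilinear idfun (fun d => smul4 a b c d).
Proof.
do 2!apply: semi_bigsum => ?; apply: semi_scale.
exact/tens_semil/mul_semil.
Qed.

Lemma smul4_bilin (a b : A) : bilin idfun (smul4 a b).
Proof. by split=> *; [apply: smul4_semi3 | apply: smul4_semi4]. Qed.

Lemma tmul_bilin2 (y : tensor A A) :
  bilin idfun (fun a b => tlift (smul4 a b) y).
Proof.
split=> [b|a]; split=> *; rewrite -/(tlift _ _).
- elim/tensor_ind: y => [|s t sE tE|c d].
  + by rewrite !(semi0 (bilin_semi (smul4_bilin _ _))) addr0.
  + by rewrite !(proj1 (bilin_semi (smul4_bilin _ _))) sE tE addrACA.
  + by rewrite !(tliftEb _ _ (smul4_bilin _ _)) (proj1 (smul4_semi1 _ _ _)).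
- elim/tensor_ind: y => [|s t sE tE|c d].
  + by rewrite !(semi0 (bilin_semi (smul4_bilin _ _))) scaler0.
  + by rewrite !(proj1 (bilin_semi (smul4_bilin _ _))) sE tE scalerDr.
  + by rewrite !(tliftEb _ _ (smul4_bilin _ _)) (proj2 (smul4_semi1 _ _ _)).
- elim/tensor_ind: y => [|s t sE tE|c d].
  + by rewrite !(semi0 (bilin_semi (smul4_bilin _ _))) addr0.
  + by rewrite !(proj1 (bilin_semi (smul4_bilin _ _))) sE tE addrACA.
  + by rewrite !(tliftEb _ _ (smul4_bilin _ _)) (proj1 (smul4_semi2 _ _ _)).
- elim/tensor_ind: y => [|s t sE tE|c d].
  + by rewrite !(semi0 (bilin_semi (smul4_bilin _ _))) scaler0.
  + by rewrite !(proj1 (bilin_semi (smul4_bilin _ _))) sE tE scalerDr.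
  + by rewrite !(tliftEb _ _ (smul4_bilin _ _)) (proj2 (smul4_semi2 _ _ _)).
Qed.

Lemma tmulE (a b c d : A) : tmul (tens a b) (tens c d) = smul4 a b c d.
Proof.
by rewrite /tmul (tliftEb _ _ (tmul_bilin2 _)) (tliftEb _ _ (smul4_bilin _ _)).
Qed.

Lemma tmul_bilin : bilin idfun (@tmul F A).
Proof.
split=> [y|x]; first exact: bilin_semi (tmul_bilin2 y).
have tl y := bilin_semi (tmul_bilin2 y).
split=> [y z|c y]; elim/tensor_ind: x => [|s t sE tE|a b].
- by rewrite /tmul !(semi0 (tl _)) addr0.
- by rewrite {}/tmul in sE tE *; rewrite !(proj1 (tl _)) sE tE addrACA.
- by rewrite /tmul !(tliftEb _ _ (tmul_bilin2 _))
    (proj1 (bilin_semi (smul4_bilin _ _))).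
- by rewrite /tmul !(semi0 (tl _)) scaler0.
- by rewrite {}/tmul in sE tE *; rewrite !(proj1 (tl _)) sE tE scalerDr.
- by rewrite /tmul !(tliftEb _ _ (tmul_bilin2 _))
    (proj2 (bilin_semi (smul4_bilin _ _))).
Qed.

End TensorMul.

Section TensorMulNat.
Variables (F K : fieldType) (j : {rmorphism F -> K}) (A : superAlgType F).
Variables (B : superAlgType K) (f : A -> B).
Hypotheses (fs : semilinear j f) (fM : {morph f : x y / x * y}).
Hypothesis (fp : forall b x, f (spart b x) = spart b (f x)).

Lemma smul4_nat a b c d :
  tmap f f (smul4 a b c d) = smul4 (f a) (f b) (f c) (f d).
Proof.
have ms := tmap_semi fs fs.
rewrite (semi_sum _ _ ms); apply: eq_bigr => i _.
rewrite (semi_sum _ _ ms); apply: eq_bigr => k _.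
by rewrite (proj2 ms) (tmapE _ _ fs fs) !fM !fp rmorph_sign.
Qed.

Lemma tmul_nat x y : tmap f f (tmul x y) = tmul (tmap f f x) (tmap f f y).
Proof.
have ms := tmap_semi fs fs; have [tl tr] := tmul_bilin A.
have [ul ur] := tmul_bilin B.
elim/tensor_ind: x => [|s t sE tE|a b].
- by rewrite (semi0 (tl _)) !(semi0 ms) (semi0 (ul _)).
- by rewrite (proj1 (tl _)) !(proj1 ms) sE tE (proj1 (ul _)).
elim/tensor_ind: y => [|s t sE tE|c d].
- by rewrite (semi0 (tr _)) !(semi0 ms) (semi0 (ur _)).
- by rewrite (proj1 (tr _)) !(proj1 ms) sE tE (proj1 (ur _)).
by rewrite tmulE !(tmapE _ _ fs fs) tmulE smul4_nat.
Qed.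
End TensorMulNat.

Section BaseChangeHopf.
Variables (F K : fieldType) (j : {rmorphism F -> K}) (A : hopfSuperType F).
Local Notation AK := (bc j A).
Local Notation inA := (@bcin F K j A).

Let ins : semilinear j inA := bcin_semi j A.

Definition bcmul (x y : AK) : AK :=
  bcext (fun a => bcext (fun b => bcin j (a * b)) y) x.

Let inner a : semilinear j (fun b : A => inA (a * b)).
Proof. exact: semi_comp_l' (mul_semil a) ins. Qed.

Let outer (y : AK) : semilinear j (fun a : A => bcext (fun b => inA (a * b)) y).
Proof.
split=> [a a'|c a]; elim/bc_ind: y => [|x y xE yE|k b].
- by rewrite !(semi0 (bcext_semi (inner _))) addr0.
- by rewrite !(proj1 (bcext_semi (inner _))) xE yE addrACA.
- rewrite !(proj2 (bcext_semi (inner _))) !(bcextE (inner _)).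
  by rewrite mulrDl (proj1 ins) scalerDr.
- by rewrite !(semi0 (bcext_semi (inner _))) scaler0.
- by rewrite !(proj1 (bcext_semi (inner _))) xE yE scalerDr.
- rewrite !(proj2 (bcext_semi (inner _))) !(bcextE (inner _)).
  by rewrite -scalerAl (proj2 ins) !scalerA mulrC.
Qed.

Lemma bcmul_semir (y : AK) : semilinear idfun (fun x => bcmul x y).
Proof. exact: bcext_semi (outer y). Qed.

Lemma bcmul_in a b : bcmul (inA a) (inA b) = inA (a * b).
Proof. by rewrite /bcmul (bcextE (outer _)) (bcextE (inner _)). Qed.

Lemma bcmul_semil (x : AK) : semilinear idfun (bcmul x).
Proof.
have os y := bcext_semi (outer y).
split=> [y z|c y]; elim/bc_ind: x => [|s t sE tE|k a]; rewrite /bcmul.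
- by rewrite !(semi0 (os _)) addr0.
- by rewrite {}/bcmul in sE tE *; rewrite !(proj1 (os _)) sE tE addrACA.
- rewrite !(proj2 (os _)) !(bcextE (outer _)) -scalerDr.
  by rewrite (proj1 (bcext_semi (inner _))).
- by rewrite !(semi0 (os _)) scaler0.
- by rewrite {}/bcmul in sE tE *; rewrite !(proj1 (os _)) sE tE scalerDr.
- rewrite !(proj2 (os _)) !(bcextE (outer _)).
  by rewrite (proj2 (bcext_semi (inner _))) /= !scalerA mulrC.
Qed.

Let bm0 x : bcmul x 0 = 0. Proof. exact: semi0 (bcmul_semil x). Qed.
Let b0m x : bcmul 0 x = 0. Proof. exact: semi0 (bcmul_semir x). Qed.
Let bmD : right_distributive bcmul +%R.
Proof. by move=> x y z; rewrite (proj1 (bcmul_semil x)). Qed.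
Let bDm : left_distributive bcmul +%R.
Proof. by move=> x y z; rewrite (proj1 (bcmul_semir z)). Qed.
Let bmZ k x y : bcmul x (k *: y) = k *: bcmul x y.
Proof. exact: (proj2 (bcmul_semil x)). Qed.
Let bZm k x y : bcmul (k *: x) y = k *: bcmul x y.
Proof. exact: (proj2 (bcmul_semir y)). Qed.

Lemma bcmulA : associative bcmul.
Proof.
move=> x y z.
elim/bc_ind: x => [|x x' xE x'E|k a]; first by rewrite !b0m.
  by rewrite !bDm xE x'E.
elim/bc_ind: y => [|y y' yE y'E|l b]; first by rewrite !(b0m, bm0).
  by rewrite !(bDm, bmD) yE y'E.
elim/bc_ind: z => [|z z' zE z'E|m c]; first by rewrite !bm0.
  by rewrite !bmD zE z'E.
by rewrite !(bZm, bmZ) !bcmul_in mulrA !scalerA mulrC mulrA.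
Qed.
Lemma bcmul1 : left_id (inA 1) bcmul.
Proof.
apply: (bc_eq (bcmul_semil _) (semi_id _)) => a.
by rewrite bcmul_in mul1r.
Qed.
Lemma bc1mul : right_id (inA 1) bcmul.
Proof.
apply: (bc_eq (bcmul_semir _) (semi_id _)) => a.
by rewrite bcmul_in mulr1.
Qed.

Definition bccounit : AK -> K := @bcext F K j A K^o (fun a => j (counit a)).

Lemma counit_semi :
  @semilinear F K j A K^o (fun a => j (counit a)).
Proof.
have [D Z] := (linear_semi (counit : A -> F^o)).1 (@counit_linear F A).
by split=> *; rewrite ?D ?Z ?rmorphD ?rmorphM.
Qed.
Lemma bccounit_semi : @semilinear K K idfun AK K^o bccounit.
Proof. exact: bcext_semi counit_semi. Qed.
Lemma bccounit_in a : bccounit (inA a) = j (counit a).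
Proof. exact: bcextE counit_semi a. Qed.

Lemma bc1_neq0 : inA 1 != 0.
Proof.
apply/eqP => /(congr1 bccounit); rewrite bccounit_in counit1 rmorph1.
by rewrite (semi0 bccounit_semi); apply/eqP/oner_neq0.
Qed.

HB.instance Definition _ := GRing.Zmodule_isNzRing.Build AK
  bcmulA bcmul1 bc1mul bDm bmD bc1_neq0.
Let bcAl k (x y : AK) : k *: (x * y) = (k *: x) * y.
Proof. by rewrite [RHS]bZm. Qed.
Let bcAr k (x y : AK) : k *: (x * y) = x * (k *: y).
Proof. by rewrite [RHS]bmZ. Qed.
HB.instance Definition _ := GRing.Lmodule_isLalgebra.Build K AK bcAl.
HB.instance Definition _ := GRing.Lalgebra_isAlgebra.Build K AK bcAr.

Lemma bcin1 : inA 1 = 1. Proof. by []. Qed.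
Lemma bcinM : {morph inA : a b / a * b}.
Proof. by move=> a b; rewrite -bcmul_in. Qed.

Lemma bcpart1 : homog false (1 : AK).
Proof. by rewrite /homog -bcin1 bc_spart_in homog1. Qed.

Lemma spart_homog (L : fieldType) (V : superModType L) b (v : V) :
  homog b (spart b v).
Proof. by rewrite /homog spartK eqxx. Qed.

Lemma bcpartM b c (x y : AK) : homog b x -> homog c y -> homog (b (+) c) (x * y).
Proof.
move=> <- <-.
have [bD bZ] := spart_semi AK b; have [cD cZ] := spart_semi AK c.
have [sD sZ] := spart_semi AK (b (+) c); rewrite /homog.
elim/bc_ind: x => [|x x' xE x'E|k a].
- by rewrite (semi0 (conj bD bZ)) mul0r (semi0 (conj sD sZ)).
- by rewrite bD mulrDl sD xE x'E.
elim/bc_ind: y => [|y y' yE y'E|l a'].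
- by rewrite (semi0 (conj cD cZ)) mulr0 (semi0 (conj sD sZ)).
- by rewrite cD mulrDr sD yE y'E.
rewrite bZ cZ !bc_spart_in -scalerAl -scalerAr !sZ -bcinM bc_spart_in /=.
by rewrite (homogM _ _ _ _ (spart_homog _ _) (spart_homog _ _)).
Qed.

HB.instance Definition _ := Algebra_isSuper.Build K AK bcpart1 bcpartM.

Lemma bc_supercommute b c (x y : AK) :
  homog b x -> homog c y -> x * y = (-1) ^+ (b && c) * (y * x).
Proof.
move=> <- <-.
have [bD bZ] := spart_semi AK b; have [cD cZ] := spart_semi AK c.
elim/bc_ind: x => [|x x' xE x'E|k a].
- by rewrite (semi0 (conj bD bZ)) !(mulr0, mul0r).
- by rewrite bD mulrDl xE x'E -mulrDr -mulrDr.
elim/bc_ind: y => [|y y' yE y'E|l a'].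
- by rewrite (semi0 (conj cD cZ)) !(mulr0, mul0r).
- by rewrite cD mulrDr yE y'E -mulrDr -mulrDl.
rewrite bZ cZ !bc_spart_in -!(scalerAl, scalerAr) -!bcinM /=.
have inN z : inA (- z) = - inA z.
  by rewrite -scaleN1r (proj2 ins) rmorphN1 scaleN1r.
rewrite (supercommute _ _ _ _ (spart_homog b a) (spart_homog c a')).
case: (b && c); rewrite ?expr0 ?expr1 ?mul1r ?mulN1r ?inN !scalerA;
  by rewrite ?scalerN 1?[l * k]mulrC.
Qed.

Definition bccomul : AK -> tensor AK AK :=
  bcext (fun a => tmap inA inA (comul a)).
Definition bcantipode : AK -> AK := bcext (fun a => inA (antipode a)).

Let comul_s : semilinear idfun (@comul F A) :=
  (linear_semi _).1 (@comul_linear F A).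
Let antip_s : semilinear idfun (@antipode F A) :=
  (linear_semi _).1 (@antipode_linear F A).
Let J : tensor A A -> tensor AK AK := tmap inA inA.
Let Js : semilinear j J := tmap_semi ins ins.
Let Jcs : semilinear j (fun a => J (comul a)) := semi_comp_l' comul_s Js.
Let ans : semilinear j (fun a => inA (antipode a)) := semi_comp_l' antip_s ins.

Lemma bccomul_semi : semilinear idfun bccomul. Proof. exact: bcext_semi Jcs. Qed.
Lemma bccomul_in a : bccomul (inA a) = tmap inA inA (comul a).
Proof. exact: bcextE Jcs a. Qed.
Lemma bcantipode_semi : semilinear idfun bcantipode.
Proof. exact: bcext_semi ans. Qed.
Lemma bcantipode_in a : bcantipode (inA a) = inA (antipode a).
Proof. exact: bcextE ans a. Qed.

Lemma bccomul_linear : linear bccomul.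
Proof. exact/linear_semi/bccomul_semi. Qed.
Lemma bcantipode_linear : linear bcantipode.
Proof. exact/linear_semi/bcantipode_semi. Qed.
Lemma bccounit_linear : scalar bccounit.
Proof. exact: (linear_semi (bccounit : AK -> K^o)).2 bccounit_semi. Qed.

Lemma bccomul_even b x : bccomul (spart b x) = spart b (bccomul x).
Proof.
have ls := semi_comp_l' (spart_semi AK b) bccomul_semi.
have rs := semi_comp_l' bccomul_semi (spart_semi _ b).
apply: (bc_eq ls rs) => a /=.
rewrite bc_spart_in !bccomul_in comul_even.
by apply: tpart_nat ins ins _ _ => c v; rewrite bc_spart_in.
Qed.

Lemma bcantipode_even b x : bcantipode (spart b x) = spart b (bcantipode x).
Proof.
have ls := semi_comp_l' (spart_semi AK b) bcantipode_semi.
have rs := semi_comp_l' bcantipode_semi (spart_semi _ b).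
apply: (bc_eq ls rs) => a /=.
by rewrite bc_spart_in !bcantipode_in antipode_even bc_spart_in.
Qed.

Lemma bccomul1 : bccomul 1 = tens 1 1.
Proof. by rewrite -bcin1 bccomul_in comul1 (tmapE _ _ ins ins). Qed.

Lemma bccomulM x y : bccomul (x * y) = tmul (bccomul x) (bccomul y).
Proof.
have [cD cZ] := bccomul_semi; have c0 := semi0 bccomul_semi.
have [tl tr] := tmul_bilin AK.
elim/bc_ind: x => [|x x' xE x'E|k a].
- by rewrite mul0r c0 (semi0 (tl _)).
- by rewrite mulrDl !cD xE x'E (proj1 (tl _)).
rewrite -scalerAl !cZ (proj2 (tl _)); congr (_ *: _).
elim/bc_ind: y => [|y y' yE y'E|l b].
- by rewrite mulr0 c0 (semi0 (tr _)).
- by rewrite mulrDr !cD yE y'E (proj1 (tr _)).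
rewrite -scalerAr !cZ (proj2 (tr _)); congr (_ *: _).
rewrite -bcinM !bccomul_in comulM; apply: (tmul_nat ins bcinM) => c z.
by rewrite bc_spart_in.
Qed.

Lemma bccounit_even x : bccounit (spart true x) = 0.
Proof.
have zs : @semilinear K K idfun AK K^o (fun=> 0).
  by split=> *; rewrite ?addr0 ?scaler0.
apply: (bc_eq (semi_comp_l' (spart_semi AK true) bccounit_semi) zs) => a.
by rewrite bc_spart_in bccounit_in counit_even rmorph0.
Qed.
Lemma bccounit1 : bccounit 1 = 1.
Proof. by rewrite -bcin1 bccounit_in counit1 rmorph1. Qed.
Lemma bccounitM : {morph bccounit : x y / x * y}.
Proof.
have [cD cZ] := bccounit_semi; have c0 := semi0 bccounit_semi.
have cM k z : bccounit (k *: z) = k * bccounit z := cZ k z.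
move=> x y; elim/bc_ind: x => [|x x' xE x'E|k a].
- by rewrite mul0r c0 mul0r.
- by rewrite mulrDl !cD xE x'E mulrDl.
rewrite -scalerAl !cM -mulrA; congr (_ * _).
elim/bc_ind: y => [|y y' yE y'E|l b].
- by rewrite mulr0 c0 mulr0.
- by rewrite mulrDr !cD yE y'E mulrDr.
rewrite -scalerAr !cM mulrCA; congr (_ * _).
by rewrite -bcinM !bccounit_in counitM rmorphM.
Qed.

Lemma bccomulA x :
  tassoc (tmap bccomul (fun y : AK => y) (bccomul x))
  = tmap (fun y : AK => y) bccomul (bccomul x).
Proof.
have cs := bccomul_semi; have ids := semi_id AK; have ids' := semi_id A.
have ls := semi_comp_l' (semi_comp_l' cs (tmap_semi cs ids)) (tassoc_semi _ _ _).
have rs := semi_comp_l' cs (tmap_semi ids cs).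
apply: (bc_eq ls rs) => a /=; rewrite bccomul_in.
rewrite (tmap_square _ comul_s ids' cs ids ins ins Js ins) //; last first.
  exact: bccomul_in.
rewrite (tmap_square _ ids' comul_s ids cs ins ins ins Js) //; last first.
  exact: bccomul_in.
by rewrite -comulA; apply: (tassoc_nat ins ins ins).
Qed.

Lemma bccounit_comul x :
  tlift (fun y z => bccounit y *: z) (bccomul x) = x.
Proof.
have [D Z] := bccounit_semi.
have bK : bilin idfun (fun y z : AK => bccounit y *: z).
  split=> [z|y]; split=> *; rewrite ?D ?Z ?scalerDl ?scalerA ?scalerDr //.
  by rewrite mulrC.
have bF : bilin idfun (fun y z : A => counit y *: z).
  have [D' Z'] := (linear_semi (counit : A -> F^o)).1 (@counit_linear F A).
  split=> [z|y]; split=> *; rewrite ?D' ?Z' ?scalerDl ?scalerA ?scalerDr //.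
  by rewrite mulrC.
apply: (bc_eq (semi_comp_l' bccomul_semi (bilin_semi bK)) (semi_id _)) => a.
rewrite bccomul_in (tlift_tmap _ ins ins bK) -[in RHS](counit_comul a).
rewrite (semi_tlift _ bF ins); apply: eq_tlift => y z.
by rewrite bccounit_in (proj2 ins).
Qed.

Lemma bccomul_counit x :
  tlift (fun y z => bccounit z *: y) (bccomul x) = x.
Proof.
have [D Z] := bccounit_semi.
have bK : bilin idfun (fun y z : AK => bccounit z *: y).
  split=> [z|y]; split=> *; rewrite ?D ?Z ?scalerDl ?scalerA ?scalerDr //.
  by rewrite mulrC.
have bF : bilin idfun (fun y z : A => counit z *: y).
  have [D' Z'] := (linear_semi (counit : A -> F^o)).1 (@counit_linear F A).
  split=> [z|y]; split=> *; rewrite ?D' ?Z' ?scalerDl ?scalerA ?scalerDr //.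
  by rewrite mulrC.
apply: (bc_eq (semi_comp_l' bccomul_semi (bilin_semi bK)) (semi_id _)) => a.
rewrite bccomul_in (tlift_tmap _ ins ins bK) -[in RHS](comul_counit a).
rewrite (semi_tlift _ bF ins); apply: eq_tlift => y z.
by rewrite bccounit_in (proj2 ins).
Qed.

Let bcunit_s : semilinear idfun (fun x => bccounit x *: (1 : AK)).
Proof.
by have [D Z] := bccounit_semi; split=> *; rewrite ?D ?Z ?scalerDl ?scalerA.
Qed.

Lemma bcantipode_comul x :
  tlift (fun y z => bcantipode y * z) (bccomul x) = bccounit x *: 1.
Proof.
have [D Z] := bcantipode_semi; have [D' Z'] := antip_s.
have bK : bilin idfun (fun y z : AK => bcantipode y * z).
  by split=> [z|y]; split=> *; rewrite ?D ?Z ?mulrDl ?mulrDr -?scalerAl -?scalerAr.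
have bF : bilin idfun (fun y z : A => antipode y * z).
  by split=> [z|y]; split=> *; rewrite ?D' ?Z' ?mulrDl ?mulrDr -?scalerAl -?scalerAr.
apply: (bc_eq (semi_comp_l' bccomul_semi (bilin_semi bK)) bcunit_s) => a.
rewrite bccomul_in (tlift_tmap _ ins ins bK) bccounit_in -(proj2 ins).
rewrite -antipode_comul (semi_tlift _ bF ins); apply: eq_tlift => y z.
by rewrite bcantipode_in bcinM.
Qed.

Lemma bccomul_antipode x :
  tlift (fun y z => y * bcantipode z) (bccomul x) = bccounit x *: 1.
Proof.
have [D Z] := bcantipode_semi; have [D' Z'] := antip_s.
have bK : bilin idfun (fun y z : AK => y * bcantipode z).
  by split=> [z|y]; split=> *; rewrite ?D ?Z ?mulrDl ?mulrDr -?scalerAl -?scalerAr.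
have bF : bilin idfun (fun y z : A => y * antipode z).
  by split=> [z|y]; split=> *; rewrite ?D' ?Z' ?mulrDl ?mulrDr -?scalerAl -?scalerAr.
apply: (bc_eq (semi_comp_l' bccomul_semi (bilin_semi bK)) bcunit_s) => a.
rewrite bccomul_in (tlift_tmap _ ins ins bK) bccounit_in -(proj2 ins).
rewrite -comul_antipode (semi_tlift _ bF ins); apply: eq_tlift => y z.
by rewrite bcantipode_in bcinM.
Qed.

HB.instance Definition _ := SuperAlgebra_isHopf.Build K AK
  bc_supercommute bccomul_linear bccomul_even bccomul1 bccomulM
  bccounit_linear bccounit_even bccounit1 bccounitM
  bcantipode_linear bcantipode_even bccomulA bccounit_comul bccomul_counit
  bcantipode_comul bccomul_antipode.

End BaseChangeHopf.

(* Right supercomodules. *)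
Record rep (F : fieldType) (A : hopfSuperType F) := Rep {
  rep_car :> superModType F;
  coact : rep_car -> tensor rep_car A;
  coact_linear : linear coact;
  coact_even : forall b v, coact (spart b v) = spart b (coact v);
  coactA : forall v,
    tassoc (tmap coact (fun a : A => a) (coact v))
    = tmap (fun w : rep_car => w) comul (coact v);
  coact_counit : forall v, tlift (fun w a => counit a *: w) (coact v) = v
}.

Section RepTheory.
Variables (F : fieldType) (A : hopfSuperType F).

Definition rep_hom (V W : rep A) (f : V -> W) : Prop :=
  [/\ linear f, forall b v, f (spart b v) = spart b (f v)
    & forall v, coact (f v) = tmap f (fun a : A => a) (coact v)].

Definition rep_iso (V W : rep A) : Prop :=
  exists f : V -> W, rep_hom f /\ bijective f.

(* W contains a subrepresentation isomorphic to V *)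
Definition rep_embeds (V W : rep A) : Prop :=
  exists f : V -> W, rep_hom f /\ injective f.

Definition subrep (V : rep A) (U : V -> Prop) : Prop :=
  [/\ U 0, forall a u v, U u -> U v -> U (a *: u + v),
      forall b v, U v -> U (spart b v)
    & forall v, U v -> exists s : seq (V * A),
        (forall p, p \in s -> U p.1) /\
        coact v = \sum_(p <- s) tens p.1 p.2].

Definition irreducible (V : rep A) : Prop :=
  (exists v : V, v != 0) /\
  forall U : V -> Prop, subrep U ->
    (forall v, U v -> v = 0) \/ (forall v, U v).

Record irrep := Irrep { irr_rep :> rep A; irrP : irreducible irr_rep }.

Section ParityChange.
Variable V : rep A.

Definition pi_car : Type := V.
HB.instance Definition _ := GRing.Lmodule.copy pi_car V.

Definition pi_part (b : bool) : pi_car -> pi_car := @spart F V (~~ b).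

Lemma pi_part_linear b : linear (pi_part b).
Proof. exact: spart_linear. Qed.
Lemma pi_partK b c v :
  pi_part b (pi_part c v) = if b == c then pi_part c v else 0.
Proof. by rewrite /pi_part spartK (inj_eq negb_inj). Qed.
Lemma pi_part_sum v : pi_part false v + pi_part true v = v.
Proof. by rewrite addrC; apply: (@spart_sum F V). Qed.
HB.instance Definition _ :=
  Lmodule_isSuper.Build F pi_car pi_part_linear pi_partK pi_part_sum.

Definition pi_coact : pi_car -> tensor pi_car A := @coact F A V.

Lemma pi_coact_even b v : pi_coact (spart b v) = spart b (pi_coact v).
Proof.
rewrite [LHS](@coact_even F A V (~~ b)) [LHS]addrC.
by rewrite /spart /= /tpart negbK.
Qed.

Definition parity_change : rep A :=
  @Rep F A pi_car pi_coact (@coact_linear F A V) pi_coact_even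
    (@coactA F A V) (@coact_counit F A V).
End ParityChange.

End RepTheory.

Record hopf_semimor (F K : fieldType) (j : {rmorphism F -> K})
    (A : hopfSuperType F) (B : hopfSuperType K) := HopfSemimor {
  hsm :> A -> B;
  hsm_semi : semilinear j hsm;
  hsm1 : hsm 1 = 1;
  hsmM : {morph hsm : x y / x * y};
  hsm_even : forall b x, hsm (spart b x) = spart b (hsm x);
  hsm_comul : forall x, comul (hsm x) = tmap hsm hsm (comul x);
  hsm_counit : forall x, counit (hsm x) = j (counit x)
}.

Section BaseChangeRep.
Variables (F K : fieldType) (j : {rmorphism F -> K}).
Variables (A : hopfSuperType F) (B : hopfSuperType K).
Variables (h : hopf_semimor j A B) (V : rep A).

Definition bccoact : bc j V -> tensor (bc j V) B :=
  bcext (fun v => tmap (bcin j) h (coact v)).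

Let ins : semilinear j (@bcin F K j V) := bcin_semi j V.
Let hs : semilinear j h := hsm_semi h.
Let coact_s : semilinear idfun (@coact F A V) :=
  (linear_semi _).1 (@coact_linear F A V).
Let Js : semilinear j (tmap (@bcin F K j V) h) := tmap_semi ins hs.
Let Jcs : semilinear j (fun v => tmap (@bcin F K j V) h (coact v)) :=
  semi_comp_l' coact_s Js.

Lemma bccoact_semi : semilinear idfun bccoact. Proof. exact: bcext_semi Jcs. Qed.
Lemma bccoact_in v : bccoact (bcin j v) = tmap (bcin j) h (coact v).
Proof. exact: bcextE Jcs v. Qed.

Lemma bccoact_linear : linear bccoact.
Proof. exact/linear_semi/bccoact_semi. Qed.

Lemma bccoact_even b v : bccoact (spart b v) = spart b (bccoact v).
Proof.
have ts : semilinear idfun (spart b : tensor (bc j V) B -> tensor (bc j V) B).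
  exact: tpart_semi.
have ls := semi_comp_l' (spart_semi (bc j V) b) bccoact_semi.
have rs := semi_comp_l' bccoact_semi ts.
apply: (bc_eq ls rs) => w /=; rewrite bc_spart_in !bccoact_in coact_even.
by apply: (tpart_nat _ _ ins hs) => c u; rewrite ?bc_spart_in ?hsm_even.
Qed.

Lemma bccoactA v :
  tassoc (tmap bccoact (fun a : B => a) (bccoact v))
  = tmap (fun w : bc j V => w) comul (bccoact v).
Proof.
have cs := bccoact_semi; have ids := semi_id B; have ids' := semi_id A.
have idv := semi_id V; have idv' := semi_id (bc j V).
have ms : semilinear idfun (@comul K B) := (linear_semi _).1 (@comul_linear K B).
have ms' : semilinear idfun (@comul F A) := (linear_semi _).1 (@comul_linear F A).
have ls := semi_comp_l' (semi_comp_l' cs (tmap_semi cs ids)) (tassoc_semi _ _ _).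
have rs := semi_comp_l' cs (tmap_semi idv' ms).
apply: (bc_eq ls rs) => w /=; rewrite bccoact_in.
rewrite (tmap_square _ coact_s ids' cs ids ins hs Js hs) //; last first.
  exact: bccoact_in.
rewrite (tmap_square _ idv ms' idv' ms ins hs ins (tmap_semi hs hs)) //; last first.
  exact: hsm_comul.
by rewrite -coactA; apply: (tassoc_nat ins hs hs).
Qed.

Lemma bccoact_counit v :
  tlift (fun (w : bc j V) (a : B) => counit a *: w) (bccoact v) = v.
Proof.
have bK : bilin idfun (fun (w : bc j V) (a : B) => counit a *: w).
  have [D Z] := (linear_semi (counit : B -> K^o)).1 (@counit_linear K B).
  split=> [z|y]; split=> *; rewrite ?D ?Z ?scalerDl ?scalerA ?scalerDr //.
  by rewrite mulrC.
have bF : bilin idfun (fun (w : V) (a : A) => counit a *: w).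
  have [D' Z'] := (linear_semi (counit : A -> F^o)).1 (@counit_linear F A).
  split=> [z|y]; split=> *; rewrite ?D' ?Z' ?scalerDl ?scalerA ?scalerDr //.
  by rewrite mulrC.
apply: (bc_eq (semi_comp_l' bccoact_semi (bilin_semi bK)) (semi_id _)) => w.
rewrite bccoact_in (tlift_tmap _ ins hs bK) -[in RHS](coact_counit w).
rewrite (semi_tlift _ bF ins); apply: eq_tlift => y z.
by rewrite hsm_counit (proj2 ins).
Qed.

(* The base change of V along j, with coefficients moved from A to B by h. *)
Definition rep_along : rep B :=
  Rep bccoact_linear bccoact_even bccoactA bccoact_counit.

End BaseChangeRep.

Section ScalarExtension.
Variables (F K : fieldType) (j : {rmorphism F -> K}) (A : hopfSuperType F).

Definition bcin_hopf : hopf_semimor j A (bc j A).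
Proof.
apply: (@HopfSemimor _ _ _ _ _ (@bcin F K j A)).
- exact: bcin_semi.
- exact: bcin1.
- exact: bcinM.
- by move=> b x; rewrite bc_spart_in.
- exact: bccomul_in.
- exact: bccounit_in.
Defined.

Definition rep_bc (V : rep A) : rep (bc j A) := rep_along bcin_hopf V.

End ScalarExtension.

Record galois (F K : fieldType) (j : {rmorphism F -> K}) := Galois {
  galois_map :> {rmorphism K -> K};
  galois_bij : bijective galois_map;
  galois_fix : forall x, galois_map (j x) = j x
}.

Section GaloisTwist.
Variables (F K : fieldType) (j : {rmorphism F -> K}) (s : galois j).

(* sigma (x) id_V on K (x)_F V *)
Definition bcgal (V : lmodType F) : bc j V -> bc j V :=
  tlift (fun (k : restr j) v => bctens j (s (k : K)) v).

Section Module.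
Variable V : lmodType F.

Lemma bcgal_bal : balanced (fun (k : restr j) (v : V) => bctens j (s (k : K)) v).
Proof.
split=> [l l' v|l v v'|a l v]; rewrite /bctens.
- by rewrite rmorphD; apply: tensDl.
- exact: tensDr.
- rewrite restr_scaleE rmorphM galois_fix tensZr.
  exact: (tensZl a (s (l : K) : restr j)).
Qed.
Lemma bcgal_bctens k (v : V) : bcgal (bctens j k v) = bctens j (s k) v.
Proof. exact: tliftE bcgal_bal. Qed.

Lemma bcgal_semi : semilinear s (@bcgal V).
Proof.
have bD : {morph @bcgal V : x y / x + y} := tliftD bcgal_bal.
split=> // k; elim/bctens_ind => [|x y xE yE|l v].
- by rewrite scaler0 [bcgal 0]tlift0 ?scaler0 //; apply: bcgal_bal.
- by rewrite scalerDr !bD xE yE scalerDr.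
- rewrite [k *: bctens j l v]bcscaleE !bcgal_bctens.
  by rewrite [RHS]bcscaleE rmorphM.
Qed.

Lemma bcgal_in (v : V) : bcgal (bcin j v) = bcin j v.
Proof. by rewrite bcgal_bctens rmorph1. Qed.
End Module.

Arguments bcgal {V}.
Variable A : hopfSuperType F.

Definition bcgal_hopf : hopf_semimor s (bc j A) (bc j A).
Proof.
have gs := bcgal_semi A; have ins := bcin_semi j A.
apply: (@HopfSemimor _ _ _ _ _ (@bcgal A)) => //.
- by rewrite -bcin1 bcgal_in.
- have [D Z] := gs; have g0 := semi0 gs.
  move=> x y; elim/bc_ind: x => [|x x' xE x'E|k a].
  + by rewrite mul0r g0 mul0r.
  + by rewrite mulrDl !D mulrDl xE x'E.
  elim/bc_ind: y => [|y y' yE y'E|l b].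
  + by rewrite mulr0 g0 mulr0.
  + by rewrite mulrDr !D mulrDr yE y'E.
  rewrite -scalerAl -scalerAr !Z -scalerAl -scalerAr -bcinM !bcgal_in.
  by rewrite bcinM.
- move=> b; have [D Z] := gs; have [D' Z'] := spart_semi (bc j A) b.
  have ls : semilinear s (fun x => bcgal (spart b x : bc j A)).
    by split=> *; rewrite ?D' ?Z' ?D ?Z.
  have rs : semilinear s (fun x => spart b (bcgal x : bc j A)).
    by split=> *; rewrite ?D ?Z ?D' ?Z'.
  by apply: (bc_eq ls rs) => a; rewrite bc_spart_in !bcgal_in bc_spart_in.
- have [D Z] := gs; have [D' Z'] := bccomul_semi j A.
  have ms := tmap_semi gs gs; have [D2 Z2] := ms.
  have ls : semilinear s (fun x => bccomul (bcgal x : bc j A)).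
    by split=> *; rewrite ?D ?Z ?D' ?Z'.
  have rs : semilinear s (fun x => tmap (@bcgal A) (@bcgal A) (bccomul x)).
    by split=> *; rewrite ?D' ?Z' ?D2 ?Z2.
  apply: (bc_eq ls rs) => a; rewrite bcgal_in !bccomul_in.
  have [D3 Z3] := tmap_semi ins ins.
  elim/tensor_ind: (comul a) => [|x y xE yE|x y].
  + by rewrite (semi0 (conj D3 Z3)) (semi0 ms).
  + by rewrite D3 D2 -xE -yE.
  + by rewrite (tmapE _ _ ins ins) (tmapE _ _ gs gs) !bcgal_in.
- have [D Z] := gs; have [D' Z'] := bccounit_semi j A.
  have ls : @semilinear K K s (bc j A) K^o (fun x => bccounit (bcgal x : bc j A)).
    by split=> *; rewrite ?D ?Z ?D' ?Z'.
  have rs : @semilinear K K s (bc j A) K^o (fun x => s (bccounit x)).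
    by split=> *; rewrite ?D' ?Z' ?rmorphD ?rmorphM.
  apply: (bc_eq ls rs) => a.
  by rewrite bcgal_in bccounit_in galois_fix.
Defined.

(* The base change of V along s; K (x)_F A is its own base change along s since
   s fixes F, the identification being sigma (x) id_A. *)
Definition rep_gal (V : rep (bc j A)) : rep (bc j A) := rep_along bcgal_hopf V.

End GaloisTwist.

(* Unital subalgebras of the endomorphism algebra of a nonzero module; the
   module is nonzero because algType requires 1 != 0. *)
Record endo_closed (F : fieldType) (V : lmodType F) := EndoClosed {
  ec_pred :> (V -> V) -> Prop;
  ec_neq0 : exists v : V, v != 0;
  ec_linear : forall f, ec_pred f -> linear f;
  ec_id : ec_pred (fun v => v);
  ec_comb : forall a f g, ec_pred f -> ec_pred g ->
    ec_pred (fun v => a *: f v + g v);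
  ec_comp : forall f g, ec_pred f -> ec_pred g -> ec_pred (fun v => f (g v))
}.

Section Endo.
Variables (F : fieldType) (V : lmodType F) (P : endo_closed V).

Record endo := Endo { efun :> V -> V; efunP : P efun }.
HB.instance Definition _ := gen_eqMixin endo.
HB.instance Definition _ := gen_choiceMixin endo.

Lemma endo_eq (f g : endo) : f =1 g -> f = g.
Proof.
case: f g => f fP [g gP] /= /funext fg; rewrite fg in fP *.
by congr Endo; apply: Prop_irrelevance.
Qed.

Lemma endo_semi (f : endo) : semilinear idfun f.
Proof. exact/linear_semi/(ec_linear (efunP f)). Qed.

Let P0 : P (fun v => 0).
Proof.
have := ec_comb (-1) (ec_id P) (ec_id P); congr ec_pred.
by apply: funext => v; rewrite scaleN1r addNr.
Qed.
Let PZ a (f : endo) : P (fun v => a *: f v).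
Proof.
have := ec_comb a (efunP f) P0; congr ec_pred.
by apply: funext => v; rewrite addr0.
Qed.
Let PD (f g : endo) : P (fun v => f v + g v).
Proof.
have := ec_comb 1 (efunP f) (efunP g); congr ec_pred.
by apply: funext => v; rewrite scale1r.
Qed.
Let PN (f : endo) : P (fun v => - f v).
Proof. by have := PZ (-1) f; congr ec_pred; apply: funext => v; rewrite scaleN1r. Qed.

Definition endo0 := Endo P0.
Definition endoD f g := Endo (PD f g).
Definition endoN f := Endo (PN f).
Definition endoZ a f := Endo (PZ a f).
Definition endo1 := Endo (ec_id P).
Definition endoM (f g : endo) := Endo (ec_comp (efunP f) (efunP g)).

Let endoDA : associative endoD.
Proof. by move=> f g h; apply: endo_eq => v; apply: addrA. Qed.
Let endoDC : commutative endoD.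
Proof. by move=> f g; apply: endo_eq => v; apply: addrC. Qed.
Let endo0D : left_id endo0 endoD.
Proof. by move=> f; apply: endo_eq => v; apply: add0r. Qed.
Let endoND : left_inverse endo0 endoN endoD.
Proof. by move=> f; apply: endo_eq => v; apply: addNr. Qed.
HB.instance Definition _ :=
  GRing.isZmodule.Build endo endoDA endoDC endo0D endoND.

Let endoMA : associative endoM.
Proof. by move=> f g h; apply: endo_eq. Qed.
Let endo1M : left_id endo1 endoM.
Proof. by move=> f; apply: endo_eq. Qed.
Let endoM1 : right_id endo1 endoM.
Proof. by move=> f; apply: endo_eq. Qed.
Let endoMDl : left_distributive endoM +%R.
Proof. by move=> f g h; apply: endo_eq. Qed.
Let endoMDr : right_distributive endoM +%R.
Proof. by move=> f g h; apply: endo_eq => v; apply: (proj1 (endo_semi f)). Qed.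
Let endo1_neq0 : endo1 != 0.
Proof.
case: (ec_neq0 P) => v; apply: contraNneq => e; apply/eqP.
exact: (congr1 (fun f : endo => f v) e).
Qed.
HB.instance Definition _ := GRing.Zmodule_isNzRing.Build endo
  endoMA endo1M endoM1 endoMDl endoMDr endo1_neq0.

Let endoZA a b f : endoZ a (endoZ b f) = endoZ (a * b) f.
Proof. by apply: endo_eq => v; apply: scalerA. Qed.
Let endoZ1 : left_id 1 endoZ.
Proof. by move=> f; apply: endo_eq => v; apply: scale1r. Qed.
Let endoZDr : right_distributive endoZ +%R.
Proof. by move=> a f g; apply: endo_eq => v; apply: scalerDr. Qed.
Let endoZDl f : {morph endoZ^~ f : a b / a + b}.
Proof. by move=> a b; apply: endo_eq => v; apply: scalerDl. Qed.
HB.instance Definition _ := GRing.Zmodule_isLmodule.Build F endo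
  endoZA endoZ1 endoZDr endoZDl.

Let endoAl a (f g : endo) : a *: (f * g) = (a *: f) * g.
Proof. by apply: endo_eq. Qed.
Let endoAr a (f g : endo) : a *: (f * g) = f * (a *: g).
Proof. by apply: endo_eq => v; apply/esym/(proj2 (endo_semi f)). Qed.
HB.instance Definition _ := GRing.Lmodule_isLalgebra.Build F endo endoAl.
HB.instance Definition _ := GRing.Lalgebra_isAlgebra.Build F endo endoAr.

Lemma endoDE (f g : endo) v : (f + g) v = f v + g v. Proof. by []. Qed.
Lemma endoZE a (f : endo) v : (a *: f) v = a *: f v. Proof. by []. Qed.
Lemma endoME (f g : endo) v : (f * g) v = f (g v). Proof. by []. Qed.
Lemma endo1E v : (1 : endo) v = v. Proof. by []. Qed.

End Endo.

Section EndRep.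
Variables (F : fieldType) (A : hopfSuperType F) (V : irrep A).

Lemma rep_hom_tmap_id (W : rep A) x :
  tmap (fun w : W => w) (fun a : A => a) x = x.
Proof.
have ids := semi_id W; have ida := semi_id A.
apply: (tensor_eq (tmap_semi ids ida) (semi_id _)) => w a.
exact: (tmapE _ _ ids ida).
Qed.

(* linear, commuting with the coaction, and of parity b: for b = false the
   homomorphisms V -> V, for b = true the homomorphisms V -> Pi V *)
Definition rep_homb (b : bool) (f : V -> V) : Prop :=
  if b then rep_hom (V := V) (W := parity_change V) f
  else rep_hom (V := V) (W := V) f.

Lemma rep_hombP b f : rep_homb b f <->
  [/\ linear f, forall c v, f (spart c v) = spart (b (+) c) (f v)
    & forall v, coact (f v) = tmap f (fun a : A => a) (coact v)].
Proof. by case: b; split. Qed.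

Lemma rep_homb_id : rep_homb false (fun v => v).
Proof. by apply/rep_hombP; split=> // v; rewrite rep_hom_tmap_id. Qed.

Lemma rep_homb_comb b a f g : rep_homb b f -> rep_homb b g ->
  rep_homb b (fun v => a *: f v + g v).
Proof.
move=> /rep_hombP[fL fp fc] /rep_hombP[gL gp gc]; apply/rep_hombP.
have [fs gs] := ((linear_semi _).1 fL, (linear_semi _).1 gL).
have [sD sZ] := linear_semi (@coact F A V).
have [cD cZ] := (linear_semi _).1 (@coact_linear F A V).
have hs := semi_add (semi_scale a fs) gs.
have ids := semi_id A; split; first exact/linear_semi.
- move=> c v; have [pD pZ] := spart_semi V (b (+) c).
  by rewrite fp gp pD pZ.
- move=> v; rewrite cD cZ fc gc.
  have ls := semi_add (semi_scale a (tmap_semi fs ids)) (tmap_semi gs ids).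
  apply: (tensor_eq ls (tmap_semi hs ids)) => w c.
  rewrite (tmapE _ _ fs ids) (tmapE _ _ gs ids) (tmapE _ _ hs ids).
  by rewrite tensDl tensZl.
Qed.

Lemma rep_homb_comp b c f g : rep_homb b f -> rep_homb c g ->
  rep_homb (b (+) c) (fun v => f (g v)).
Proof.
move=> /rep_hombP[fL fp fc] /rep_hombP[gL gp gc]; apply/rep_hombP.
have [fs gs] := ((linear_semi _).1 fL, (linear_semi _).1 gL).
have ids := semi_id A; have hs := semi_comp_l' gs fs.
split; first exact/linear_semi.
- by move=> d v; rewrite gp fp addbA.
- move=> v; rewrite fc gc.
  have ls := semi_comp_l' (tmap_semi gs ids) (tmap_semi fs ids).
  apply: (tensor_eq ls (tmap_semi hs ids)) => w d.
  by rewrite (tmapE _ _ gs ids) (tmapE _ _ fs ids) (tmapE _ _ hs ids).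
Qed.

Let V_neq0 : exists v : V, v != 0 := proj1 (irrP V).

Definition EndG_closed : endo_closed V :=
  @EndoClosed F V (rep_homb false) V_neq0
    (fun f fP => let: And3 fL _ _ := (rep_hombP false f).1 fP in fL)
    rep_homb_id (@rep_homb_comb false) (@rep_homb_comp false false).

Definition EndG := endo EndG_closed.
HB.instance Definition _ := GRing.Algebra.on EndG.

Definition uEnd_pred (f : V -> V) : Prop :=
  exists f0 f1, [/\ rep_homb false f0, rep_homb true f1
                  & forall v, f v = f0 v + f1 v].

Lemma rep_homb0 b : rep_homb b (fun=> 0).
Proof.
have hid := rep_homb_id.
apply/rep_hombP; have ids := semi_id A.
have [cD cZ] := (linear_semi _).1 (@coact_linear F A V).
have zs : semilinear idfun (fun _ : V => 0 : V).
  by split=> *; rewrite ?addr0 ?scaler0.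
split; first exact/linear_semi.
- by move=> c v; rewrite (semi0 (spart_semi V _)).
- move=> v; rewrite (semi0 (conj cD cZ)).
  have zs' : semilinear idfun (fun _ : tensor V A => 0 : tensor V A).
    by split=> *; rewrite ?addr0 ?scaler0.
  apply: (tensor_eq zs' (tmap_semi zs ids)) => w a.
  by rewrite (tmapE _ _ zs ids) tens0l.
Qed.

Lemma uEnd_linear f : uEnd_pred f -> linear f.
Proof.
move=> [f0 [f1 [/rep_hombP[L0 _ _] /rep_hombP[L1 _ _] fE]]] a u v.
by rewrite !fE L0 L1 scalerDr addrACA.
Qed.
Lemma uEnd_id : uEnd_pred (fun v => v).
Proof.
exists (fun v => v), (fun=> 0); split; [exact: rep_homb_id|exact: rep_homb0|].
by move=> v; rewrite addr0.
Qed.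
Lemma uEnd_comb a f g : uEnd_pred f -> uEnd_pred g ->
  uEnd_pred (fun v => a *: f v + g v).
Proof.
move=> [f0 [f1 [h0 h1 fE]]] [g0 [g1 [k0 k1 gE]]].
exists (fun v => a *: f0 v + g0 v), (fun v => a *: f1 v + g1 v).
split; [exact: rep_homb_comb|exact: rep_homb_comb|move=> v].
by rewrite fE gE scalerDr addrACA.
Qed.
Let combD b f g : rep_homb b f -> rep_homb b g -> rep_homb b (fun v => f v + g v).
Proof.
move=> fP gP; have := rep_homb_comb 1 fP gP; congr rep_homb.
by apply: funext => v; rewrite scale1r.
Qed.
Lemma uEnd_comp f g : uEnd_pred f -> uEnd_pred g ->
  uEnd_pred (fun v => f (g v)).
Proof.
move=> [f0 [f1 [h0 h1 fE]]] [g0 [g1 [k0 k1 gE]]].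
exists (fun v => f0 (g0 v) + f1 (g1 v)), (fun v => f0 (g1 v) + f1 (g0 v)); split.
- exact: combD (rep_homb_comp h0 k0) (rep_homb_comp h1 k1).
- exact: combD (rep_homb_comp h0 k1) (rep_homb_comp h1 k0).
- move=> v; rewrite fE gE.
  have [D0 _] := (linear_semi _).1 (let: And3 L _ _ := (rep_hombP _ _).1 h0 in L).
  have [D1 _] := (linear_semi _).1 (let: And3 L _ _ := (rep_hombP _ _).1 h1 in L).
  by rewrite D0 D1 [X in _ + X = _]addrC addrACA.
Qed.

Definition uEnd_closed : endo_closed V :=
  @EndoClosed F V uEnd_pred V_neq0 uEnd_linear uEnd_id uEnd_comb uEnd_comp.

(* End_G(V) + Hom_G(V, Pi V) *)
Definition uEnd := endo uEnd_closed.
HB.instance Definition _ := GRing.Algebra.on uEnd.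

Definition par_fun (b : bool) (f : V -> V) (v : V) : V :=
  spart b (f (spart false v)) + spart (~~ b) (f (spart true v)).

Lemma par_funE (f f0 f1 : V -> V) b v :
  rep_homb false f0 -> rep_homb true f1 -> (forall v, f v = f0 v + f1 v) ->
  par_fun b f v = (if b then f1 else f0) v.
Proof.
move=> /rep_hombP[L0 p0 _] /rep_hombP[L1 p1 _] fE.
have [D0 _] := (linear_semi _).1 L0; have [D1 _] := (linear_semi _).1 L1.
rewrite /par_fun !fE !p0 !p1 !(proj1 (spart_semi V _)) !spartK /=.
case: b; rewrite /= ?(add0r, addr0); first by rewrite addrC spart_sum.
exact: spart_sum.
Qed.

Lemma par_homb b f : uEnd_pred f -> rep_homb b (par_fun b f).
Proof.
move=> [f0 [f1 [h0 h1 fE]]].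
rewrite (_ : par_fun b f = if b then f1 else f0); first by case: b.
by apply: funext => v; rewrite (par_funE _ _ h0 h1 fE).
Qed.

Lemma par_uEnd b f : uEnd_pred f -> uEnd_pred (par_fun b f).
Proof.
move=> /(par_homb b) fP; case: b fP => fP.
- by exists (fun=> 0), (par_fun true f); split=> // *;
    rewrite ?add0r //; apply: rep_homb0.
- by exists (par_fun false f), (fun=> 0); split=> // *;
    rewrite ?addr0 //; apply: rep_homb0.
Qed.

Definition uEnd_part (b : bool) (f : uEnd) : uEnd :=
  @Endo F V uEnd_closed (par_fun b f) (par_uEnd b (efunP f)).

Lemma uEnd_part_linear b : linear (uEnd_part b).
Proof.
move=> a f g; apply: endo_eq => v /=.
change (par_fun b (fun w => a *: f w + g w) v
        = a *: par_fun b f v + par_fun b g v).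
rewrite /par_fun !spart_linear scalerDr; exact: addrACA.
Qed.

Lemma uEnd_partK b c f :
  uEnd_part b (uEnd_part c f) = if b == c then uEnd_part c f else 0.
Proof.
apply: endo_eq => v /=.
have [f0 [f1 [h0 h1 fE]]] := efunP f.
have h := par_homb c (efunP f).
have z b' := rep_homb0 b'.
case: c h => h; case: b => /=.
- by rewrite (@par_funE _ (fun=> 0) (par_fun true f)) // => *; rewrite add0r.
- by rewrite (@par_funE _ (fun=> 0) (par_fun true f)) // => *; rewrite add0r.
- by rewrite (@par_funE _ (par_fun false f) (fun=> 0)) // => *; rewrite addr0.
- by rewrite (@par_funE _ (par_fun false f) (fun=> 0)) // => *; rewrite addr0.
Qed.

Lemma uEnd_part_sum f : uEnd_part false f + uEnd_part true f = f.
Proof.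
apply: endo_eq => v; have [f0 [f1 [h0 h1 fE]]] := efunP f.
by rewrite endoDE /= !(par_funE _ _ h0 h1 fE) fE.
Qed.

HB.instance Definition _ :=
  Lmodule_isSuper.Build F uEnd uEnd_part_linear uEnd_partK uEnd_part_sum.

Lemma uEnd_homogP b (f : uEnd) : homog b f <-> rep_homb b f.
Proof.
split=> [<-|fP]; first exact: (par_homb b (efunP f)).
apply: endo_eq => v; rewrite /= /homog.
case: b fP => fP.
- by rewrite (@par_funE _ (fun=> 0) f) // => *; rewrite ?add0r //; apply: rep_homb0.
- by rewrite (@par_funE _ f (fun=> 0)) // => *; rewrite ?addr0 //; apply: rep_homb0.
Qed.

Lemma uEnd_homog1 : homog false (1 : uEnd).
Proof. by apply/uEnd_homogP/rep_homb_id. Qed.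
Lemma uEnd_homogM b c (f g : uEnd) :
  homog b f -> homog c g -> homog (b (+) c) (f * g).
Proof. by move=> /uEnd_homogP fP /uEnd_homogP gP; apply/uEnd_homogP/rep_homb_comp. Qed.
HB.instance Definition _ := Algebra_isSuper.Build F uEnd uEnd_homog1 uEnd_homogM.

End EndRep.

Section EvenPart.
Variables (F : fieldType) (A : superAlgType F).

Definition even_part : {pred A} := [pred x | spart false x == x].

Lemma even_partP x : reflect (homog false x) (x \in even_part).
Proof. exact: eqP. Qed.

Lemma even_part_subalg : subalg_closed even_part.
Proof.
have [D Z] := spart_semi A false; split.
- exact/even_partP/homog1.
- move=> a u v /even_partP uE /even_partP vE; apply/even_partP.
  by rewrite /homog D Z uE vE.
- move=> u v /even_partP uE /even_partP vE; apply/even_partP.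
  exact: (@homogM F A false false).
Qed.

HB.instance Definition _ := GRing.isSubalgClosed.Build F A even_part
  even_part_subalg.

Record even_alg := EvenAlg { even_val :> A; _ : even_val \in even_part }.
HB.instance Definition _ := [isSub for even_val].
HB.instance Definition _ := [Choice of even_alg by <:].
HB.instance Definition _ := [SubChoice_isSubAlgebra of even_alg by <:].

End EvenPart.

Section Brauer.
Variable F : fieldType.

Definition mx_alg_iso (A B : algType F) (m n : nat) : Prop :=
  exists f : 'M[A]_m -> 'M[B]_n,
    [/\ bijective f, {morph f : M N / M + N}, {morph f : M N / M *m N},
        f 1%:M = 1%:M
      & forall (a : F) M,
          f (map_mx (fun x => a *: x) M) = map_mx (fun x => a *: x) (f M)].

(* [A] = [B] in Br(F): M_m(A) and M_n(B) are isomorphic for some m, n > 0. *)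
Definition brauer_eq (A B : algType F) : Prop :=
  exists m n : nat, mx_alg_iso A B m.+1 n.+1.

Definition findim (V : lmodType F) : Prop :=
  exists s : seq V, forall v, exists c : nat -> F,
    v = \sum_(i < size s) c i *: s`_i.

Definition ideal (A : algType F) (I : A -> Prop) : Prop :=
  [/\ I 0, forall x y, I x -> I y -> I (x + y)
    & forall a b x, I x -> I (a * x * b)].

Definition central_simple (A : algType F) : Prop :=
  [/\ findim A,
      forall z : A, (forall x, z * x = x * z) -> exists c : F, z = c%:A
    & forall I : A -> Prop, ideal I ->
        (forall x, I x -> x = 0) \/ (forall x, I x)].

Definition central_simple_super (A : superAlgType F) : Prop :=
  [/\ findim A,
      forall z : A, homog false z -> (forall x, z * x = x * z) ->
        exists c : F, z = c%:A
    & forall I : A -> Prop, ideal I ->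
        (forall b x, I x -> I (spart b x)) ->
        (forall x, I x -> x = 0) \/ (forall x, I x)].

Definition square_eq (a b : F) : Prop := exists2 c : F, c != 0 & a = c ^+ 2 * b.

Inductive bw_sign := BWplus | BWminus.

(* The class of A in BW(F) corresponds to (e, d, [B]), with d in F^* taken
   modulo squares; evaluated on the representative A of its class. *)
Definition bw_inv (A : superAlgType F) (e : bw_sign) (d : F) (B : algType F) :
    Prop :=
  central_simple_super A /\
  match e with
  | BWplus =>
      [/\ central_simple A,
          brauer_eq A B
        & (forall x : A, spart true x = 0) /\ square_eq d 1 \/
          (exists x : A, spart true x != 0) /\
          exists (u : A) (a : F),
            [/\ homog false u,
                forall z : A, homog false z ->
                  ((forall x, homog false x -> z * x = x * z) <->
                   exists b c : F, z = b%:A + c *: u),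
                forall b c : F, b%:A + c *: u = 0 -> b = 0 /\ c = 0,
                u * u = a%:A /\ a != 0
              & square_eq d a]]
  | BWminus =>
      [/\ ~ central_simple A,
          brauer_eq (even_alg A) B
        & exists (u : A) (a : F),
            [/\ homog true u, u != 0,
                forall x, homog false x -> u * x = x * u,
                u * u = a%:A /\ a != 0
              & square_eq d a]]
  end.

End Brauer.

Definition separable_closure (F Fs : fieldType) (j : {rmorphism F -> Fs}) : Prop :=
  (forall x : Fs, exists p : {poly F},
     separable_poly p /\ root (map_poly j p) x) /\
  (forall p : {poly Fs}, separable_poly p -> (1 < size p)%N ->
     exists x, root p x).

Definition quasi_rational (F Fs : fieldType) (j : {rmorphism F -> Fs})
    (A : hopfSuperType F) (V : rep (bc j A)) : Prop :=
  irreducible V /\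
  (forall f : V -> V, rep_hom f -> exists c : Fs, forall v, f v = c *: v) /\
  (forall s : galois j, rep_iso (rep_gal s V) V).

Definition absolutely_irreducible (F : fieldType) (A : hopfSuperType F)
    (V : rep A) : Prop :=
  forall (K : fieldType) (j : {rmorphism F -> K}), irreducible (rep_bc j V).

(* Main.v *)
(* Everything reduces to the condition End(VF) = F.

   If V is the base change of W, then W is irreducible and End(W) = F because
   End(V) = Fs; composing W -> W_Fs -> (VF)_Fs with a linear form Fs -> F gives
   a nonzero map W -> VF, an isomorphism by Schur's lemma, so End(VF) = F.
   Conversely, End(VF) = F makes VF absolutely irreducible by a density argument
   on a subrepresentation of (VF)_K: the length of a nonzero tensor in it can be
   reduced to one.  If VF is absolutely irreducible, the embedding of V in
   (VF)_Fs is onto.  A division algebra whose Brauer class is trivial is F, so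
   [End(VF)] = 0 also means End(VF) = F, and then the division superalgebra
   End(VF) + Hom(VF, Pi VF) is F or F + Fu with u odd and u^2 in F^*.

   A coaction is studied through the operators (id (x) phi) o coact, for phi a
   linear form on the Hopf superalgebra; enough linear forms exist by Zorn's
   lemma, and subrepresentations and homomorphisms can be recognised on these
   operators. *)

From mathcomp Require Import all_boot all_algebra.
From mathcomp Require Import boolp classical_sets.
Require Import Defs.
Import GRing.Theory.
Local Open Scope ring_scope.
Set Implicit Arguments.
Unset Strict Implicit.
Unset Printing Implicit Defensive.

(** * Subspaces and separating linear forms *)

Definition subspace (F : fieldType) (V : lmodType F) (M : V -> Prop) : Prop :=
  M 0 /\ forall c u v, M u -> M v -> M (c *: u + v).

Definition functional (F : fieldType) (V : lmodType F) (phi : V -> F) : Prop :=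
  @semilinear F F idfun V F^o phi.

Section Functionals.
Variables (F : fieldType) (V : lmodType F).
Implicit Types (M N : V -> Prop) (a v : V) (phi : V -> F).

Lemma subspaceZ M c v : subspace M -> M v -> M (c *: v).
Proof. by case=> M0 MC Mv; rewrite -[c *: v]addr0; apply: MC. Qed.

Lemma subspaceD M u v : subspace M -> M u -> M v -> M (u + v).
Proof. by case=> M0 MC Mu Mv; rewrite -[u]scale1r; apply: MC. Qed.

Lemma subspaceN M v : subspace M -> M v -> M (- v).
Proof. by move=> Ms Mv; rewrite -scaleN1r; apply: subspaceZ. Qed.

Lemma subspaceB M u v : subspace M -> M u -> M v -> M (u - v).
Proof. by move=> Ms Mu Mv; apply: subspaceD => //; apply: subspaceN. Qed.

Lemma subspace_sum M (I : eqType) (s : seq I) (f : I -> V) :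
  subspace M -> (forall i, i \in s -> M (f i)) -> M (\sum_(i <- s) f i).
Proof.
move=> Ms Mf; rewrite big_seq.
by apply: big_ind => [|u v|//]; [case: Ms | apply: subspaceD].
Qed.

(** By Zorn's lemma there is a maximal subspace [N] above [M] that misses [a]. It is a hyperplane:
    if [v] is outside [N], maximality puts [a] into [N + F v], and the coefficient of [v] there is
    nonzero because [a] is not in [N]. *)
Lemma maximal_subspace_avoiding M a : subspace M -> ~ M a ->
  exists N, [/\ subspace N, forall v, M v -> N v, ~ N a
    & forall v, exists c, N (v - c *: a)].
Proof.
move=> Ms Ma.
(* The empty set is admitted because Zorn_bigcup also takes the union of the
   empty chain. *)
pose P : set (set V) := fun X => [/\ forall c u v, X u -> X v -> X (c *: u + v),
  ~ X a & forall x, X x -> forall v, M v -> X v].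
have [|N [[NC Na NM] Nmax]] := @Zorn_bigcup V P.
  move=> C CP Ctot; split.
  - move=> c u v [X CX Xu] [Y CY Yv].
    have [XY|YX] := Ctot _ _ CX CY.
    + by exists Y => //; have [YC _ _] := CP _ CY; apply: YC => //; apply: XY.
    + by exists X => //; have [XC _ _] := CP _ CX; apply: XC => //; apply: YX.
  - by move=> [X CX Xa]; have [_ /(_ Xa)] := CP _ CX.
  - move=> x [X CX Xx] v Mv; exists X => //.
    by have [_ _ /(_ _ Xx _ Mv)] := CP _ CX.
(* [N] is not empty, since otherwise [M] would be a larger member of [P]. *)
have MN v : M v -> N v.
  case: (pselect (exists x, N x)) => [[x Nx]|Nx]; first exact: NM Nx v.
  case: (Nmax M); last by split=> //; case: Ms.
  split=> [x Nx'|MN]; first by case: Nx; exists x.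
  by case: Nx; exists 0; apply: MN; case: Ms.
have Ns : subspace N by split=> //; apply: MN; case: Ms.
exists N; split=> // v.
case: (pselect (N v)) => [Nv|Nv]; first by exists 0; rewrite scale0r subr0.
pose X : set V := fun x => exists c, N (x - c *: v).
have XN x : N x -> X x by exists 0; rewrite scale0r subr0.
have Xa : X a.
  apply: contrapT => Xa; case: (Nmax X).
    split=> // XsN; apply: Nv; apply: XsN.
    by exists 1; rewrite scale1r subrr; case: Ns.
  split=> // [c u w [b Nb] [d Nd]|x _ w Mw]; last exact/XN/MN.
  exists (c * b + d).
  rewrite (_ : _ - _ = c *: (u - b *: v) + (w - d *: v)); last first.
    by rewrite scalerBr scalerA scalerDl opprD addrACA.
  exact: NC.
case: Xa => c Nc.
have c0 : c != 0 by apply: contra_notN Na => /eqP c0; rewrite c0 scale0r subr0 in Nc.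
exists c^-1; have := subspaceZ (- c^-1) Ns Nc.
by rewrite scalerBr scalerA mulNr mulVf // !scaleNr scale1r opprK addrC.
Qed.

(** Modulo the hyperplane [N] every [v] is a unique multiple of [a]; [phi v] is the coefficient. *)
Lemma functional_separates M a : subspace M -> ~ M a ->
  exists phi, [/\ functional phi, forall v, M v -> phi v = 0 & phi a = 1].
Proof.
move=> Ms /(maximal_subspace_avoiding Ms)[N [Ns MN Na Nex]].
have Nuniq c d v : N (v - c *: a) -> N (v - d *: a) -> c = d.
  move=> Nc Nd; apply/eqP; rewrite -subr_eq0; apply: contra_notT Na => cd.
  have := subspaceZ (c - d)^-1 Ns (subspaceB Ns Nd Nc).
  rewrite opprB [X in _ *: X]addrC addrA subrK -scalerBl scalerA mulVf //.
  by rewrite scale1r.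
have [phi phiP] := choice Nex.
exists phi; split=> [|v Mv|].
- split=> [u v|c v]; apply: Nuniq (phiP _) _.
  + rewrite scalerDl opprD addrACA; exact: subspaceD.
  + rewrite -[_ *: a]scalerA -scalerBr; exact: subspaceZ.
- by apply: Nuniq (phiP v) _; rewrite scale0r subr0; apply: MN.
- by apply: Nuniq (phiP a) _; rewrite scale1r subrr; case: Ns.
Qed.

Lemma functional_nonzero v : v != 0 -> exists2 phi, functional phi & phi v = 1.
Proof.
move=> v0; have Z : subspace (fun x : V => x = 0).
  by split=> // c x y -> ->; rewrite scaler0 addr0.
by have [|phi [phiF _ ?]] := functional_separates Z (a := v);
  [exact/eqP | exists phi].
Qed.

End Functionals.

(** * Tensors and linear forms *)

(** Recursion on the list lets [tsum_absorbr] and [tsum_absorbl] treat one coefficient at a time. *)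
Fixpoint lin_span (F : fieldType) (V : lmodType F) (s : seq V) (x : V) : Prop :=
  if s is y :: s' then exists c z, lin_span s' z /\ x = c *: y + z else x = 0.

Section Span.
Variables (F : fieldType) (V : lmodType F).

Lemma lin_span_subspace (s : seq V) : subspace (lin_span s).
Proof.
elim: s => [|y s [s0 sC]] /=.
  by split=> // c u v -> ->; rewrite scaler0 addr0.
split=> [|c u v [a [z [sz ->]]] [b [t [st ->]]]].
  by exists 0, 0; rewrite scale0r addr0.
exists (c * a + b), (c *: z + t); split; first exact: sC.
by rewrite scalerDr scalerA scalerDl addrACA.
Qed.

Lemma mem_lin_span (s : seq V) y : y \in s -> lin_span s y.
Proof.
elim: s => //= z s IHs; rewrite inE => /orP[/eqP ->|/IHs ys].
  by exists 1, 0; rewrite scale1r addr0; split=> //; case: (lin_span_subspace s).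
by exists 0, y; rewrite scale0r add0r.
Qed.

End Span.

Section Contraction.
Variables (F : fieldType) (V W : lmodType F).

Lemma tens_zerol (w : W) : tens (0 : V) w = 0.
Proof. by rewrite -(scale0r 0) tensZl scale0r. Qed.

Lemma tens_zeror (v : V) : tens v (0 : W) = 0.
Proof. by rewrite -(scale0r 0) tensZr scale0r. Qed.

(** These are the maps [id (x) phi] and [phi (x) id]. *)
Definition contractr (phi : W -> F) : tensor V W -> V :=
  tlift (fun v w => phi w *: v).
Definition contractl (phi : V -> F) : tensor V W -> W :=
  tlift (fun v w => phi v *: w).

Lemma contractr_bilin phi : functional phi ->
  bilin idfun (fun (v : V) (w : W) => phi w *: v).
Proof.
case=> D Z; split=> [w|v]; split=> *; rewrite ?scalerDr ?D ?scalerDl //.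
- by rewrite !scalerA mulrC.
- by rewrite Z scalerA.
Qed.

Lemma contractl_bilin phi : functional phi ->
  bilin idfun (fun (v : V) (w : W) => phi v *: w).
Proof.
case=> D Z; split=> [w|v]; split=> *; rewrite ?scalerDr ?D ?scalerDl //.
- by rewrite Z scalerA.
- by rewrite !scalerA mulrC.
Qed.

Lemma contractr_semi phi : functional phi -> semilinear idfun (contractr phi).
Proof. by move=> /contractr_bilin/bilin_semi. Qed.

Lemma contractl_semi phi : functional phi -> semilinear idfun (contractl phi).
Proof. by move=> /contractl_bilin/bilin_semi. Qed.

Lemma contractr_tens phi v w : functional phi ->
  contractr phi (tens v w) = phi w *: v.
Proof. by move=> phiF; exact: tliftEb (contractr_bilin phiF). Qed.

Lemma contractl_tens phi v w : functional phi ->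
  contractl phi (tens v w) = phi v *: w.
Proof. by move=> phiF; exact: tliftEb (contractl_bilin phiF). Qed.

Definition tsum (s : seq (V * W)) : tensor V W := \sum_(p <- s) tens p.1 p.2.

Lemma tsum_cons v w s : tsum ((v, w) :: s) = tens v w + tsum s.
Proof. exact: big_cons. Qed.

Lemma tsum_repr (x : tensor V W) : exists s, x = tsum s.
Proof. by exists (repr x); apply: tensE. Qed.

Lemma contractr_tsum phi s : functional phi ->
  (forall w, lin_span (map snd s) w -> phi w = 0) -> contractr phi (tsum s) = 0.
Proof.
move=> phiF phi0; rewrite (semi_sum _ _ (contractr_semi phiF)).
rewrite big_seq big1 // => p ps; rewrite contractr_tens // phi0 ?scale0r //.
exact/mem_lin_span/map_f.
Qed.

Lemma contractl_tsum phi s : functional phi ->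
  (forall v, lin_span (map fst s) v -> phi v = 0) -> contractl phi (tsum s) = 0.
Proof.
move=> phiF phi0; rewrite (semi_sum _ _ (contractl_semi phiF)).
rewrite big_seq big1 // => p ps; rewrite contractl_tens // phi0 ?scale0r //.
exact/mem_lin_span/map_f.
Qed.

(** If [w = c w' + z], the part [v (x) c w'] merges with [v' (x) w'] into [(v' + c v) (x) w'], and
    [v (x) z] is spread over the remaining terms. A dependent factor thus makes a sum one term
    shorter. *)
Lemma tsum_absorbr s v w : lin_span (map snd s) w ->
  exists2 s', size s' = size s & tens v w + tsum s = tsum s'.
Proof.
elim: s v w => [|[v' w'] s IHs] v w /=.
  by move=> ->; exists [::] => //; rewrite tens_zeror add0r.
move=> [c [z [/(IHs v)[s' s's E] ->]]].
exists ((v' + c *: v, w') :: s') => /=; first by rewrite s's.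
rewrite !tsum_cons -E tensDr tensDl tensZr tensZl /=.
by rewrite addrACA [X in X + _]addrC.
Qed.

Lemma tsum_absorbl s v w : lin_span (map fst s) v ->
  exists2 s', size s' = size s & tens v w + tsum s = tsum s'.
Proof.
elim: s v w => [|[v' w'] s IHs] v w /=.
  by move=> ->; exists [::] => //; rewrite tens_zerol add0r.
move=> [c [z [/(IHs _ w)[s' s's E] ->]]].
exists ((v', w' + c *: w) :: s') => /=; first by rewrite s's.
rewrite !tsum_cons -E tensDr tensDl tensZr tensZl /=.
by rewrite addrACA [X in X + _]addrC.
Qed.

(** Induction on the length of a sum for [x]. If the leading right factor [w] depends on the others,
    the sum shrinks; otherwise a form that is 1 at [w] and 0 at the other right factors contracts
    [x] to the left factor of [w], which is therefore in [U]. *)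
Lemma tensor_support (U : V -> Prop) x : subspace U ->
  (forall phi, functional phi -> U (contractr phi x)) ->
  exists2 s, (forall p, p \in s -> U p.1) & x = tsum s.
Proof.
move=> Us; have [s ->] := tsum_repr x.
have [n] := ubnP (size s); elim: n => // n IHn in s *.
case: s => [|[v w] s] /= sn Ux; first by exists [::].
case: (pselect (lin_span (map snd s) w)) => [ws|ws].
  have [s' s's E] := tsum_absorbr v ws; rewrite tsum_cons E.
  by apply: IHn; rewrite ?s's // -E -tsum_cons.
have [phi [phiF phi0 phi1]] := functional_separates (lin_span_subspace _) ws.
have Uv : U v.
  have := Ux _ phiF; rewrite tsum_cons (proj1 (contractr_semi phiF)).
  by rewrite contractr_tens // phi1 scale1r contractr_tsum // addr0.
(* The tail contracts to the contraction of the whole sum minus [psi w *: v], again an element of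
   [U]. *)
have [|s' Us' E] := IHn s sn.
  move=> psi psiF; have := subspaceB Us (Ux _ psiF) (subspaceZ (psi w) Us Uv).
  rewrite tsum_cons (proj1 (contractr_semi psiF)) contractr_tens //.
  by rewrite addrC addKr.
exists ((v, w) :: s'); last by rewrite !tsum_cons E.
by move=> p; rewrite inE => /orP[/eqP ->|/Us'].
Qed.

Lemma contractr_inj x y :
  (forall phi, functional phi -> contractr phi x = contractr phi y) -> x = y.
Proof.
move=> xy; apply/eqP; rewrite -subr_eq0; apply/eqP.
have U0 : subspace (fun v : V => v = 0).
  by split=> // c u v -> ->; rewrite scaler0 addr0.
have [|s s0 ->] := tensor_support (x := x - y) U0.
  move=> phi phiF; have /linear_semi phiL := contractr_semi phiF.
  by rewrite -scaleN1r addrC phiL xy // scaleN1r addNr.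
by rewrite /tsum big_seq big1 // => p /s0 ->; apply: tens_zerol.
Qed.

(** As in [tensor_support] with the factors exchanged: an independent leading left factor forces its
    right factor to be 0. *)
Lemma contractl_inj0 x :
  (forall phi, functional phi -> contractl phi x = 0) -> x = 0.
Proof.
have [s ->] := tsum_repr x.
have [n] := ubnP (size s); elim: n => // n IHn in s *.
case: s => [|[v w] s] /= sn x0; first exact: big_nil.
case: (pselect (lin_span (map fst s) v)) => [vs|vs].
  have [s' s's E] := tsum_absorbl w vs; rewrite tsum_cons E.
  by apply: IHn; rewrite ?s's // -E -tsum_cons.
have [phi [phiF phi0 phi1]] := functional_separates (lin_span_subspace _) vs.
have w0 : w = 0.
  have := x0 _ phiF; rewrite tsum_cons (proj1 (contractl_semi phiF)).
  by rewrite contractl_tens // phi1 scale1r contractl_tsum // addr0.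
rewrite tsum_cons /= w0 tens_zeror add0r; apply: IHn => // psi psiF.
have := x0 _ psiF; rewrite tsum_cons (proj1 (contractl_semi psiF)).
by rewrite contractl_tens // w0 scaler0 add0r.
Qed.

End Contraction.

(** * The dual action on a comodule *)

Section DualAction.
Variables (F : fieldType) (A : hopfSuperType F).

(** The action of the linear dual of [A]. The forms need not be even; the grading is handled
    separately through [spart]. *)
Definition act (V : rep A) (phi : A -> F) (v : V) : V := contractr phi (coact v).

Lemma act_semi (V : rep A) phi : functional phi -> semilinear idfun (@act V phi).
Proof.
move=> phiF; apply: semi_comp_l' (contractr_semi _ phiF).
exact/linear_semi/coact_linear.
Qed.

Lemma act_subrep (V : rep A) (U : V -> Prop) phi v :
  subrep U -> functional phi -> U v -> U (act phi v).
Proof.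
move=> [U0 UC Up Uc] phiF /Uc[s [sU sE]]; rewrite /act sE.
rewrite (semi_sum _ _ (contractr_semi _ phiF)); apply: subspace_sum => // p ps.
by rewrite contractr_tens //; apply: subspaceZ => //; apply: sU.
Qed.

(** [tensor_support] turns stability under all contractions into an expression of [coact v] with
    left factors in [U]. *)
Lemma subrep_act (V : rep A) (U : V -> Prop) :
  subspace U -> (forall b v, U v -> U (spart b v)) ->
  (forall phi v, functional phi -> U v -> U (act phi v)) -> subrep U.
Proof.
move=> [U0 UC] Up Ua; split=> // v Uv.
have [phi phiF|s sU sE] := @tensor_support _ _ _ U (coact v) (conj U0 UC).
  exact: Ua.
by exists s.
Qed.

Lemma tmap_contractr (V W : lmodType F) (f : V -> W) (phi : A -> F) x :
  linear f -> functional phi ->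
  contractr phi (tmap f (fun a : A => a) x) = f (contractr phi x).
Proof.
move=> /linear_semi fs phiF; have ids := semi_id A.
apply: (tensor_eq (semi_comp_l' (tmap_semi fs ids) (contractr_semi _ phiF))
                  (semi_comp_l' (contractr_semi _ phiF) fs)) => v a /=.
by rewrite (tmapE _ _ fs ids) !contractr_tens // (proj2 fs).
Qed.

Lemma rep_hom_act (V W : rep A) (f : V -> W) phi v :
  rep_hom f -> functional phi -> f (act phi v) = act phi (f v).
Proof. by move=> [fL _ fc] phiF; rewrite /act fc tmap_contractr. Qed.

(** Contractions separate tensors, so compatibility with the coactions can be tested on the
    operators [act phi]. *)
Lemma act_rep_hom (V W : rep A) (f : V -> W) :
  linear f -> (forall b v, f (spart b v) = spart b (f v)) ->
  (forall phi v, functional phi -> f (act phi v) = act phi (f v)) -> rep_hom f.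
Proof.
move=> fL fp fa; split=> // v; apply: contractr_inj => phi phiF.
by rewrite tmap_contractr // fa.
Qed.

Lemma rep_hom_comp (U V W : rep A) (f : U -> V) (g : V -> W) :
  rep_hom f -> rep_hom g -> rep_hom (fun u => g (f u)).
Proof.
move=> fh gh; have [fL fp _] := fh; have [gL gp _] := gh; apply: act_rep_hom.
- by move=> a u v; rewrite fL gL.
- by move=> b v; rewrite fp gp.
- by move=> phi v phiF; rewrite (rep_hom_act _ fh) // (rep_hom_act _ gh).
Qed.

Lemma rep_hom_inv (V W : rep A) (f : V -> W) (g : W -> V) :
  rep_hom f -> cancel f g -> cancel g f -> rep_hom g.
Proof.
move=> fh fK gK; have [fL fp _] := fh; apply: act_rep_hom.
- by move=> a u v; apply: (can_inj fK); rewrite fL !gK.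
- by move=> b v; apply: (can_inj fK); rewrite fp !gK.
- by move=> phi v phiF; apply: (can_inj fK); rewrite (rep_hom_act _ fh) // !gK.
Qed.

Lemma rep_hom_kernel (V W : rep A) (f : V -> W) :
  rep_hom f -> subrep (fun v => f v = 0).
Proof.
move=> fh; have [fL fp _] := fh; have fs := (linear_semi f).1 fL.
apply: subrep_act => [|b v fv|phi v phiF fv].
- by split=> [|c u v fu fv]; rewrite ?(semi0 fs) // fL fu fv scaler0 addr0.
- by rewrite fp fv (semi0 (spart_semi _ _)).
- by rewrite (rep_hom_act _ fh) // fv (semi0 (act_semi _ phiF)).
Qed.

Lemma rep_hom_image (V W : rep A) (f : V -> W) :
  rep_hom f -> subrep (fun w => exists v, w = f v).
Proof.
move=> fh; have [fL fp _] := fh; have fs := (linear_semi f).1 fL.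
apply: subrep_act => [|b _ [v ->]|phi _ phiF [v ->]].
- split=> [|c _ _ [u ->] [v ->]]; first by exists 0; rewrite (semi0 fs).
  by exists (c *: u + v); rewrite fL.
- by exists (spart b v); rewrite fp.
- by exists (act phi v); rewrite (rep_hom_act _ fh).
Qed.

Lemma irreducible_hom_inj (V W : rep A) (f : V -> W) :
  irreducible V -> rep_hom f -> (exists v, f v != 0) -> injective f.
Proof.
move=> [_ Virr] fh [v fv]; have [fL _ _] := fh.
have [ker0|kerT] := Virr _ (rep_hom_kernel fh); last by rewrite kerT eqxx in fv.
move=> x y fxy; apply/eqP; rewrite -subr_eq0; apply/eqP/ker0.
by rewrite -scaleN1r addrC fL fxy scaleN1r addNr.
Qed.

Lemma irreducible_hom_surj (V W : rep A) (f : V -> W) :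
  irreducible W -> rep_hom f -> (exists v, f v != 0) ->
  forall w, exists v, w = f v.
Proof.
move=> [_ Wirr] fh [v fv].
have [im0|//] := Wirr _ (rep_hom_image fh).
by rewrite [f v]im0 ?eqxx in fv; exists v.
Qed.

Lemma inj_surj_inverse (S T : Type) (f : S -> T) : injective f ->
  (forall t, exists s, t = f s) -> exists2 g, cancel f g & cancel g f.
Proof.
move=> fI /choice[g gE]; have gK : cancel g f by move=> t; rewrite -gE.
by exists g => // s; apply: fI; rewrite gK.
Qed.

End DualAction.

(** * Base change of linear maps, linear forms and the dual action *)

Section BaseChangeAction.
Variables (F K : fieldType) (j : {rmorphism F -> K}).

Definition bcmap (V W : lmodType F) (r : V -> W) : bc j V -> bc j W :=
  bcext (fun v => bcin j (r v)).

Section Bcmap.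
Variables (V W : lmodType F) (r : V -> W).
Hypothesis rL : linear r.

Let rs : semilinear j (fun v => bcin j (r v)).
Proof. by apply: semi_comp_l' (bcin_semi j W); apply/linear_semi. Qed.

Lemma bcmap_semi : semilinear idfun (bcmap r).
Proof. exact: bcext_semi rs. Qed.

Lemma bcmap_in v : bcmap r (bcin j v) = bcin j (r v).
Proof. exact: bcextE rs v. Qed.

Lemma bcmap_tens k v : bcmap r (bctens j k v) = bctens j k (r v).
Proof. by rewrite !bctensE (proj2 bcmap_semi) bcmap_in. Qed.

(** The maps [lam (x) id] and [id (x) r] act on different factors. This makes maps descended along
    [lam] equivariant in [hom_descent]. *)
Lemma contractl_bcmap (lam : restr j -> F) x : functional lam ->
  contractl lam (bcmap r x) = r (contractl lam x).
Proof.
move=> lamF; have [lD lZ] := contractl_semi V lamF.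
have rs' := (linear_semi r).1 rL.
elim/bctens_ind: x => [|x y xE yE|k v].
- by rewrite (semi0 bcmap_semi) !(semi0 (contractl_semi _ lamF)) (semi0 rs').
- rewrite (proj1 bcmap_semi) [LHS](proj1 (contractl_semi W lamF)) xE yE lD.
  by rewrite (proj1 rs').
- by rewrite bcmap_tens !contractl_tens // (proj2 rs').
Qed.

End Bcmap.

Definition bcfun (V : lmodType F) (phi : V -> F) : bc j V -> K :=
  @bcext F K j V K^o (fun v => j (phi v)).

Section Bcfun.
Variables (V : lmodType F) (phi : V -> F).
Hypothesis phiF : functional phi.

Let phis : @semilinear F K j V K^o (fun v => j (phi v)).
Proof.
by have [D Z] := phiF; split=> *; rewrite ?D ?Z ?rmorphD ?rmorphM.
Qed.

Lemma bcfun_functional : functional (bcfun phi).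
Proof. exact: bcext_semi phis. Qed.

Lemma bcfun_in v : bcfun phi (bcin j v) = j (phi v).
Proof. exact: bcextE phis v. Qed.

End Bcfun.

(** Both sides are linear over [K] and agree on each [1 (x) v]. Hence a subrepresentation over [K]
    is stable under the base change of the operators [act phi] of [V]. *)
Lemma act_bc (A : hopfSuperType F) (V : rep A) phi (x : rep_bc j V) :
  functional phi -> act (bcfun phi) x = bcmap (act (V := V) phi) x.
Proof.
move=> phiF; have bF := bcfun_functional phiF.
have /linear_semi aL := act_semi V phiF.
move: x; apply: (bc_eq (act_semi (rep_bc j V) bF) (bcmap_semi aL)) => v.
rewrite bcmap_in // /act /= bccoact_in.
have ins := bcin_semi j V; have ins' := bcin_semi j A.
rewrite /contractr (tlift_tmap _ ins ins' (contractr_bilin _ bF)).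
rewrite (semi_tlift _ (contractr_bilin _ phiF) ins).
by apply: eq_tlift => w a; rewrite bcfun_in // (proj2 ins).
Qed.

(** A linear form [lam] on [K] with [lam 1 = 1] makes [lam (x) id] a retraction. *)
Lemma bcin_inj (V : lmodType F) : injective (@bcin F K j V).
Proof.
have [lam lamF lam1] := functional_nonzero (oner_neq0 K : (1 : restr j) != 0).
apply: (can_inj (g := contractl lam)) => v.
by rewrite [LHS]contractl_tens // lam1 scale1r.
Qed.

End BaseChangeAction.

(** * Density *)

Section Density.
Variables (F K : fieldType) (j : {rmorphism F -> K}) (A : hopfSuperType F).
Variable V : rep A.

Section Stable.
Variable U : rep_bc j V -> Prop.
Hypothesis Usub : subrep U.

Let Us : subspace U. Proof. by case: Usub. Qed.

(** These operators form a unital algebra over [F] that contains every [act phi] and both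
    projections [spart b]. Its orbits are therefore subrepresentations of [V], and an irreducible
    [V] is a simple module over it. *)
Definition stabilizes (r : V -> V) : Prop :=
  linear r /\ forall x, U x -> U (bcmap r x).

Lemma stabilizes_act phi : functional phi -> stabilizes (act phi).
Proof.
move=> phiF; split=> [|x Ux]; first exact/linear_semi/act_semi.
rewrite -act_bc //; apply: act_subrep => //; exact: bcfun_functional.
Qed.

Lemma stabilizes_spart b : stabilizes (spart b).
Proof.
split=> [|x Ux]; first exact: spart_linear.
by case: Usub => _ _ Up _; apply: Up.
Qed.

Lemma stabilizes_id : stabilizes (fun v => v).
Proof.
split=> // x Ux; rewrite (_ : bcmap _ x = x) //.
have idL : linear (fun v : V => v) by [].
move: x {Ux}; apply: (bc_eq (bcmap_semi j idL) (semi_id _)) => v.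
by rewrite bcmap_in.
Qed.

Lemma stabilizes_comp r s :
  stabilizes r -> stabilizes s -> stabilizes (fun v => r (s v)).
Proof.
move=> [rL rU] [sL sU].
have rsL : linear (fun v => r (s v)) by move=> a u v; rewrite sL rL.
split=> // x /sU/rU; congr U; move: x.
apply: (bc_eq (semi_comp_l' (bcmap_semi j sL) (bcmap_semi j rL))
              (bcmap_semi j rsL)) => v.
by rewrite !bcmap_in.
Qed.

Lemma stabilizes_comb a r s :
  stabilizes r -> stabilizes s -> stabilizes (fun v => a *: r v + s v).
Proof.
move=> [rL rU] [sL sU].
have rsL : linear (fun v => a *: r v + s v).
  move=> c u v; rewrite rL sL !scalerDr !scalerA [a * c]mulrC; exact: addrACA.
split=> // x Ux; have := (proj2 Us) (j a) _ _ (rU x Ux) (sU x Ux).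
congr U; move: x {Ux}.
apply: (bc_eq (semi_add (semi_scale (j a) (bcmap_semi j rL)) (bcmap_semi j sL))
              (bcmap_semi j rsL)) => v.
by rewrite !bcmap_in // (proj1 (bcin_semi j V)) (proj2 (bcin_semi j V)).
Qed.

Lemma stabilizes_orbit_subrep v : subrep (fun w => exists2 r, stabilizes r & w = r v).
Proof.
apply: subrep_act => [|b _ [r rS ->]|phi _ phiF [r rS ->]].
- split=> [|c _ _ [r rS ->] [s sS ->]].
    (* The zero operator, written as a combination of identities. *)
    exists (fun v => (-1) *: v + v); last by rewrite scaleN1r addNr.
    exact: stabilizes_comb stabilizes_id stabilizes_id.
  by exists (fun v => c *: r v + s v) => //; apply: stabilizes_comb.
- exists (fun v => spart b (r v)) => //.
  exact: stabilizes_comp (stabilizes_spart b) rS.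
- exists (fun v => act phi (r v)) => //.
  exact: stabilizes_comp (stabilizes_act phiF) rS.
Qed.

Hypothesis Virr : irreducible V.
Hypothesis Vend :
  forall f : V -> V, rep_hom f -> exists c : F, forall v, f v = c *: v.

(* The endomorphism is r v2 |-> r v1. *)
Lemma stabilizes_annihilator v1 v2 : v2 != 0 ->
  (forall r, stabilizes r -> r v2 = 0 -> r v1 = 0) -> exists c, v1 = c *: v2.
Proof.
move=> v2n0 ann.
(* The orbit of [v2] is a nonzero subrepresentation, hence all of [V]. *)
have orb w : exists r, stabilizes r /\ w = r v2.
  have [Z|T] := (proj2 Virr) _ (stabilizes_orbit_subrep v2).
    case/eqP: v2n0; apply: Z.
    by exists (fun v => v) => //; apply: stabilizes_id.
  by have [r] := T w; exists r.
have [R RP] := choice orb.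
(* The choice of [R] does not matter: by [ann], operators that agree at [v2] agree at [v1]. *)
have RE r : stabilizes r -> R (r v2) v1 = r v1.
  move=> rS; have [RS RE] := RP (r v2).
  have := ann _ (stabilizes_comb (-1) rS RS); rewrite !scaleN1r -RE addNr.
  by move=> /(_ erefl) /eqP; rewrite addrC subr_eq0 => /eqP.
have gh : rep_hom (fun w : V => R w v1).
  apply: act_rep_hom => [a u v|b v|phi v phiF].
  - have [uS uE] := RP u; have [vS vE] := RP v.
    by rewrite {1}uE {1}vE (RE _ (stabilizes_comb a uS vS)).
  - have [vS vE] := RP v; rewrite {1}vE.
    exact: (RE _ (stabilizes_comp (stabilizes_spart b) vS)).
  - have [vS vE] := RP v; rewrite {1}vE.
    exact: (RE _ (stabilizes_comp (stabilizes_act phiF) vS)).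
have [c cE] := Vend gh; exists c.
by rewrite -cE (RE _ stabilizes_id).
Qed.

(** Induction on the number of terms. Suppose [k1] is independent of the other left factors and [v2]
    is nonzero. Either some stabilizing [r] kills [v2] but not [v1], and [id (x) r] yields a nonzero
    element of [U] with fewer terms; or [v1] is a multiple of [v2] by [stabilizes_annihilator], and
    the sum shortens. *)
Lemma subrep_pure_tensor (s : seq (restr j * V)) :
  U (tsum s : bc j V) -> tsum s != 0 ->
  exists k v, U (bctens j k v) /\ bctens j k v != 0.
Proof.
have [n] := ubnP (size s); elim: n => // n IHn in s *.
case: s => [|[k1 v1] [|[k2 v2] s]] /= sn Ux x0.
- by rewrite /tsum big_nil eqxx in x0.
- by exists k1, v1; move: Ux x0; rewrite /tsum big_seq1.
have shorter s' : (size s' < n)%N -> tsum [:: (k1, v1), (k2, v2) & s] = tsum s' ->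
    exists k v, U (bctens j k v) /\ bctens j k v != 0.
  by move=> s'n E; rewrite E in Ux x0; apply: IHn Ux x0.
case: (pselect (lin_span (map fst ((k2, v2) :: s)) k1)) => [ks|ks].
  have [s' s's E] := tsum_absorbl v1 ks.
  by apply: (shorter s'); rewrite ?s's // tsum_cons.
have [v20|v2n0] := eqVneq v2 0.
  apply: (shorter ((k1, v1) :: s)) => //.
  by rewrite !tsum_cons v20 tens_zeror add0r.
case: (pselect (exists r, [/\ stabilizes r, r v2 = 0 & r v1 != 0])).
  move=> [r [[rL rU] rv2 rv1]].
  have rE (t : seq (restr j * V)) :
      bcmap r (tsum t : bc j V) = tsum [seq (p.1, r p.2) | p <- t].
    rewrite /tsum (semi_sum _ _ (bcmap_semi j rL)) big_map.
    by apply: eq_bigr => p _; apply: bcmap_tens.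
  have E : bcmap r (tsum [:: (k1, v1), (k2, v2) & s] : bc j V)
      = tsum ((k1, r v1) :: [seq (p.1, r p.2) | p <- s]).
    by rewrite rE /= !tsum_cons rv2 tens_zeror add0r.
  apply: (IHn ((k1, r v1) :: [seq (p.1, r p.2) | p <- s])).
  - by rewrite /= size_map.
  - by rewrite -E; apply: rU.
  (* A form that is 1 at [k1] and 0 at the other left factors contracts the new sum to [r v1], so
     this sum is nonzero. *)
  - apply: contraNneq rv1 => E0.
    have [lam [lamF lam0 lam1]] :=
      functional_separates (lin_span_subspace _) ks.
    have := congr1 (contractl lam) E0; rewrite (semi0 (contractl_semi _ lamF)).
    rewrite tsum_cons (proj1 (contractl_semi _ lamF)) contractl_tens // lam1.
    rewrite scale1r contractl_tsum ?addr0 // => [->//|k]; rewrite -map_comp => sk.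
    by apply: lam0; exists 0, k; rewrite scale0r add0r.
move=> ann; have [|c v1E] := @stabilizes_annihilator v1 v2 v2n0.
  move=> r rS rv2; apply: contrapT => /eqP rv1; apply: ann.
  by exists r.
have v1s : lin_span (map snd ((k2, v2) :: s)) v1.
  exists c, 0; rewrite addr0; split=> //; exact: (proj1 (lin_span_subspace _)).
have [s' s's E] := tsum_absorbr k1 v1s.
by apply: (shorter s'); rewrite ?s's // tsum_cons.
Qed.

(** A nonzero pure tensor [k (x) v] in [U] rescales to [1 (x) v]. The vectors [w] with [1 (x) w] in
    [U] then form a nonzero subrepresentation of [V], hence all of [V], and the [1 (x) w] span the
    base change. *)
Lemma subrep_bc_trivial : (forall x, U x -> x = 0) \/ (forall x, U x).
Proof.
case: (pselect (exists2 x, U x & x != 0)) => [[x Ux x0]|Z]; last first.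
  by left=> x Ux; apply: contrapT => /eqP x0; apply: Z; exists x.
right; have [s xE] := tsum_repr (x : tensor (restr j) V).
have [k [v [Ukv kv0]]] : exists k v, U (bctens j k v) /\ bctens j k v != 0.
  by apply: (@subrep_pure_tensor s); rewrite -xE.
have k0 : k != 0.
  by apply: contraNneq kv0 => ->; rewrite bctensE scale0r.
have Uv : U (bcin j v).
  have := subspaceZ k^-1 Us Ukv.
  by rewrite bctensE scalerA mulVf // scale1r.
have Wsub : subrep (fun w : V => U (bcin j w)).
  have [iD iZ] := bcin_semi j V.
  apply: subrep_act => [|b w Uw|phi w phiF Uw].
  - split=> [|c u w Uu Uw]; first by rewrite (semi0 (conj iD iZ)); case: Us.
    by rewrite iD iZ; apply: (proj2 Us).
  - rewrite -bc_spart_in; have [_ _ Up _] := Usub; exact: Up.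
  - have [aL aU] := stabilizes_act phiF.
    by have := aU _ Uw; rewrite bcmap_in.
have UT w : U (bcin j w).
  have [Z|T] := (proj2 Virr) _ Wsub; last exact: T.
  by move: kv0; rewrite bctensE (Z _ Uv) (semi0 (bcin_semi j V)) scaler0 eqxx.
elim/bc_ind => [|x1 x2 U1 U2|l w]; first by case: Us.
  exact: subspaceD.
exact: subspaceZ.
Qed.

End Stable.

End Density.

Lemma scalar_end_absolutely_irreducible (F : fieldType) (A : hopfSuperType F)
    (V : rep A) : irreducible V ->
  (forall f : V -> V, rep_hom f -> exists c : F, forall v, f v = c *: v) ->
  absolutely_irreducible V.
Proof.
move=> Virr Vend K j; split=> [|U Usub]; last exact: subrep_bc_trivial.
have [[v v0] _] := Virr; exists (bcin j v).
by apply: contraNneq v0 => /esym; rewrite -(semi0 (bcin_semi j V)) => /bcin_inj ->.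
Qed.

(** * Descent *)

Section Descent.
Variables (F K : fieldType) (j : {rmorphism F -> K}) (A : hopfSuperType F).

Lemma bcmap_rep_hom (V W : rep A) (f : V -> W) : rep_hom f ->
  @rep_hom K (bc j A) (rep_bc j V) (rep_bc j W) (bcmap f).
Proof.
move=> [fL fp fc]; have fs := (linear_semi f).1 fL.
have ids := semi_id A; have ids' := semi_id (bc j A).
have fKs := bcmap_semi j fL; split=> [|b|].
- exact/linear_semi.
- apply: (bc_eq (semi_comp_l' (spart_semi (bc j V) b) fKs)
                (semi_comp_l' fKs (spart_semi (bc j W) b))) => v.
  by rewrite bc_spart_in !bcmap_in // bc_spart_in fp.
- have cV := bccoact_semi (bcin_hopf j A) V.
  have cW := bccoact_semi (bcin_hopf j A) W.
  apply: (bc_eq (semi_comp_l' fKs cW) (semi_comp_l' cV (tmap_semi fKs ids'))) => v.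
  rewrite bcmap_in // !bccoact_in fc; apply/esym.
  have inV := bcin_semi j V; have inW := bcin_semi j W.
  have inA := bcin_semi j A.
  by apply: (tmap_square _ fs ids fKs ids' inV inA inW inA) => // w; apply: bcmap_in.
Qed.

Lemma irreducible_iso (V W : rep A) :
  irreducible V -> rep_iso V W -> irreducible W.
Proof.
move=> [[v v0] Virr] [f [fh [g fK gK]]]; have [fL fp _] := fh.
have fs := (linear_semi f).1 fL; split.
  by exists (f v); apply: contraNneq v0 => fv; rewrite -(fK v) fv -(semi0 fs) fK.
move=> U Usub; have [U0 UC Up _] := Usub.
have sub : subrep (fun u => U (f u)).
  apply: subrep_act => [|b u Uu|phi u phiF Uu].
  - by split=> [|c u w Uu Uw]; rewrite ?(semi0 fs) // fL; apply: UC.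
  - by rewrite fp; apply: Up.
  - by rewrite (rep_hom_act _ fh) //; apply: act_subrep.
have [Z|T] := Virr _ sub; [left=> w Uw|right=> w].
  by rewrite -(gK w) (Z (g w)) ?gK // (semi0 fs).
by rewrite -(gK w).
Qed.

(** The span over [K] of a subrepresentation [U] is a subrepresentation of the base change. If it is
    zero, so is [U]; if it is everything, [lam (x) id] with [lam 1 = 1] sends [1 (x) v] to [v] and
    the span into [U]. *)
Lemma irreducible_bc_descent (V : rep A) :
  irreducible (rep_bc j V) -> irreducible V.
Proof.
move=> [[x x0] Kirr]; have [iD iZ] := bcin_semi j V.
have i0 := semi0 (conj iD iZ); split.
  apply: contrapT => noV; case/eqP: x0.
  elim/bc_ind: x => [//|y z -> ->|k v]; first by rewrite addr0.
  have -> : v = 0 by apply: contrapT => /eqP v0; apply: noV; exists v.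
  by rewrite i0 scaler0.
move=> U Usub; have [U0 UC Up _] := Usub; have Us : subspace U by [].
have UKsub : @subrep K (bc j A) (rep_bc j V) (fun y => exists s : seq (K * V),
    (forall p, p \in s -> U p.2) /\ y = \sum_(p <- s) p.1 *: bcin j p.2).
  split.
  - by exists [::]; rewrite big_nil.
  - move=> c _ _ [s [sU ->]] [t [tU ->]].
    exists ([seq (c * p.1, p.2) | p <- s] ++ t); split.
      by move=> p; rewrite mem_cat => /orP[/mapP[q /sU qU ->]|/tU].
    rewrite big_cat big_map scaler_sumr; congr (_ + _).
    by apply: eq_bigr => p _; rewrite scalerA.
  - move=> b _ [s [sU ->]]; exists [seq (p.1, spart b p.2) | p <- s]; split.
      by move=> p /mapP[q /sU qU ->]; apply: Up.
    rewrite (semi_sum _ _ (spart_semi _ b)) big_map; apply: eq_bigr => p _.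
    by rewrite (proj2 (spart_semi (bc j V) b)) bc_spart_in.
  - move=> _ [s [sU ->]].
    have cs := bccoact_semi (bcin_hopf j A) V.
    elim: s sU => [|p s IHs] sU.
      exists [::]; rewrite !big_nil; split=> //; exact: semi0 cs.
    have [|t [tU tE]] := IHs; first by move=> q qs; apply: sU; rewrite inE qs orbT.
    have [_ _ _ Uc] := Usub.
    have [r [rU rE]] := Uc p.2 (sU p (mem_head _ _)).
    exists ([seq (p.1 *: bcin j q.1, bcin j q.2) | q <- r] ++ t); split.
      move=> q; rewrite mem_cat => /orP[/mapP[q' /rU q'U ->]|/tU //].
      by exists [:: (p.1, q'.1)]; rewrite big_seq1; split=> // ?; rewrite inE => /eqP->.
    rewrite big_cons big_cat big_map /= -tE [LHS](proj1 cs); congr (_ + _).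
    have ts := tmap_semi (bcin_semi j V) (bcin_semi j A).
    rewrite [LHS](proj2 cs) bccoact_in rE (semi_sum _ _ ts) scaler_sumr.
    apply: eq_bigr => q _.
    by rewrite (tmapE _ _ (bcin_semi j V) (bcin_semi j A)) tensZl.
have [Z|T] := Kirr _ UKsub; [left=> v Uv|right=> v].
  apply: (@bcin_inj _ _ j); rewrite i0; apply: Z; exists [:: (1, v)].
  by rewrite big_seq1 scale1r; split=> // p; rewrite inE => /eqP->.
have [s [sU sE]] := T (bcin j v).
have [lam lamF lam1] := functional_nonzero (oner_neq0 K : (1 : restr j) != 0).
have -> : v = contractl lam (bcin j v).
  by rewrite [RHS]contractl_tens // lam1 scale1r.
rewrite sE (semi_sum _ _ (contractl_semi _ lamF)).
apply: subspace_sum => // p /sU pU.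
by rewrite -bctensE contractl_tens //; apply: subspaceZ.
Qed.

(** Transported to [V], the base change of [f] is a scalar [c] of [K], so [1 (x) f w = c (x) w].
    Applying [lam (x) id] with [lam 1 = 1] gives the scalar [lam c] of [F]. *)
Lemma scalar_end_descent (V : rep (bc j A)) (W : rep A) :
  (forall f : V -> V, rep_hom f -> exists c : K, forall v, f v = c *: v) ->
  rep_iso V (rep_bc j W) ->
  forall f : W -> W, rep_hom f -> exists c : F, forall w, f w = c *: w.
Proof.
move=> Vend [p [ph [q pK qK]]] f fh; have [fL _ _] := fh.
have qh := rep_hom_inv ph pK qK; have [pL _ _] := ph.
have [c cE] := Vend _ (rep_hom_comp (rep_hom_comp ph (bcmap_rep_hom fh)) qh).
have [lam lamF lam1] := functional_nonzero (oner_neq0 K : (1 : restr j) != 0).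
exists (lam c) => w.
have E : bcin j (f w) = bctens j c w.
  rewrite -(bcmap_in j fL) -[bcin j w]qK -[LHS]qK cE.
  by rewrite (proj2 ((linear_semi p).1 pL)) qK bctensE.
have := congr1 (contractl lam) E.
by rewrite [X in X = _]contractl_tens // lam1 scale1r contractl_tens.
Qed.

(** The descended map sends [w] to the image of [f (1 (x) w)] under [lam (x) id]. Some [lam] keeps
    the value at [v] nonzero because such contractions detect nonzero tensors. *)
Lemma hom_descent (V W : rep A) (f : rep_bc j V -> rep_bc j W) v :
  rep_hom f -> f (bcin j v) != 0 ->
  exists g : V -> W, rep_hom g /\ g v != 0.
Proof.
move=> fh fv; have [fL fp _] := fh; have fs := (linear_semi f).1 fL.
have [lam [lamF lv]] : exists lam : restr j -> F,
    functional lam /\ contractl lam (f (bcin j v)) != 0.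
  apply: contrapT => noF; case/eqP: fv; apply: contractl_inj0 => lam lamF.
  by apply: contrapT => /eqP lv; apply: noF; exists lam.
exists (fun w => contractl lam (f (bcin j w))); split=> //.
have lamsV := contractl_semi W lamF; have [iD iZ] := bcin_semi j V.
apply: act_rep_hom => [a u w|b w|phi w phiF].
(* The scaling on the left is that of [K], whereas [contractl] is linear for the [F]-structure of
   the tensor product; the two agree along [j]. *)
- have lZ : contractl lam (j a *: f (bcin j u) : bc j W)
      = a *: contractl lam (f (bcin j u)).
    elim/bctens_ind: (f (bcin j u)) => [|x y xE yE|k y].
    + by rewrite scaler0 (semi0 lamsV) scaler0.
    + by rewrite scalerDr [LHS](proj1 lamsV) xE yE [in RHS](proj1 lamsV) scalerDr.
    + rewrite [_ *: bctens j k y]bcscaleE !contractl_tens // scalerA.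
      by congr (_ *: _); exact: (proj2 lamF).
  by rewrite iD iZ (proj1 fs) (proj2 fs) [LHS](proj1 lamsV) lZ.
- rewrite -bc_spart_in fp.
  by rewrite -(contractl_bcmap (@spart_linear _ W b) (f (bcin j w)) lamF).
- have aL (X : rep A) : linear (@act _ _ X phi) by apply/linear_semi/act_semi.
  have bF := bcfun_functional j phiF.
  rewrite -(contractl_bcmap (aL W) _ lamF) -act_bc // -(rep_hom_act _ fh) //.
  by rewrite act_bc // (bcmap_in j (aL V)).
Qed.

End Descent.

(** * Brauer and Brauer-Wall classes *)

Section ScalarAlgebra.
Variables (F : fieldType) (A : algType F).

Let algI : injective (fun c : F => c%:A : A).
Proof. exact: (fmorph_inj (in_alg A)). Qed.

Hypothesis scalarA : forall x : A, exists c : F, x = c%:A.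

Lemma scalar_brauer_eq : brauer_eq A F^o.
Proof.
have [c cE] := choice scalarA.
have cK (k : F) : c k%:A = k by apply: algI; rewrite -cE.
(* The indices [0] stand for matrices of size one. *)
exists 0, 0, (map_mx c : 'M[A]_1 -> 'M[F^o]_1); split.
- exists (map_mx (fun k : F^o => (k : F)%:A) : 'M[F^o]_1 -> 'M[A]_1) => M;
    apply/matrixP => i k; rewrite !mxE.
    by rewrite -cE.
  exact: cK.
- move=> M N; apply/matrixP => i k; rewrite !mxE; apply: algI.
  by rewrite scalerDl -!cE.
- move=> M N; apply/matrixP => i k; rewrite !mxE !big_ord1 !mxE; apply: algI.
  by rewrite -[RHS]scalerA -[RHS]mulr_algl -!cE.
- by apply/matrixP => i k; rewrite !mxE !ord1 eqxx -[1 in LHS]scale1r cK.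
- move=> a M; apply/matrixP => i k; rewrite !mxE; apply: algI.
  by rewrite -scalerA -!cE.
Qed.

Lemma scalar_central_simple : central_simple A.
Proof.
split=> [|z _|I [I0 _ IM]]; last 1 first.
- case: (pselect (exists2 x, I x & x != 0)) => [[x Ix x0]|noI]; last first.
    by left=> x Ix; apply: contrapT => /eqP x0; apply: noI; exists x.
  right=> y; have [c xE] := scalarA x.
  have c0 : c != 0 by apply: contraNneq x0 => c0; rewrite xE c0 scale0r.
  have := IM (c^-1)%:A y x Ix; rewrite xE mulr_algl scalerA mulVf //.
  by rewrite scale1r mul1r.
- exists [:: 1] => v; have [c ->] := scalarA v.
  by exists (fun=> c); rewrite big_ord1.
- exact: scalarA.
Qed.

End ScalarAlgebra.

Lemma central_simple_superW (F : fieldType) (A : superAlgType F) :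
  central_simple A -> central_simple_super A.
Proof.
by case=> Afin Acen Aid; split=> // [z _|I Iid _]; [apply: Acen | apply: Aid].
Qed.

(* If e corresponds to the matrix unit E_00 over F then e y e lies in F e for
   every y; at a nonzero entry p of e this reads p x p = c p. *)
Lemma division_brauer_trivial (F : fieldType) (A : algType F) :
  (forall x : A, x != 0 -> exists y, y * x = 1 /\ x * y = 1) ->
  brauer_eq A F^o -> forall x : A, exists c : F, x = c%:A.
Proof.
move=> Adiv [m [n [f [[h fK hK] fD fM f1 fZ]]]] x.
have f0 : f 0 = 0 by apply: (addrI (f 0)); rewrite -fD !addr0.
pose E : 'M[F^o]_n.+1 := delta_mx 0 0; pose e := h E.
have eE y : exists c : F, e *m y *m e = map_mx (fun a : A => c *: a) e.
  (* For [Y = f y], [E Y E] is the entry [Y 0 0] times [E]. *)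
  exists (f y 0 0); apply: (can_inj fK); rewrite fZ !fM hK.
  apply/matrixP => i k; rewrite !mxE (bigD1 0) //= big1 => [|l l0]; last first.
    by rewrite [E l k]mxE (negPf l0) mulr0.
  rewrite !mxE (bigD1 0) //= big1 => [|l l0]; last first.
    by rewrite !mxE (negPf l0) andbF mul0r.
  rewrite !mxE !addr0 eqxx andbT; case: (i == 0); case: (k == 0);
    by rewrite ?(mul0r, mulr0, mul1r, mulr1, scaler0) //= /GRing.scale /= ?mulr1 ?mulr0.
have [i [k p0]] : exists i k, e i k != 0.
  apply: contrapT => noe; have e0 : e = 0.
    apply/matrixP => i k; rewrite mxE; apply: contrapT => /eqP p0.
    by apply: noe; exists i, k.
  have := congr1 (fun M : 'M[F^o]_n.+1 => M 0 0) (hK E).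
  rewrite -/e e0 f0 !mxE !eqxx /= => /esym/eqP.
  by rewrite (negPf (oner_neq0 F)).
have pE y : exists c : F, e i k * y * e i k = c *: e i k.
  (* With the single entry [y] at position [(k, i)], the entry [(i, k)] of the product is
     [e i k * y * e i k]. *)
  have [c cE] := eE (\matrix_(a, b) if (a == k) && (b == i) then y else 0).
  exists c; have := congr1 (fun M : 'M[A]_m.+1 => M i k) cE; rewrite !mxE => <-.
  rewrite (bigD1 i) //= big1 ?addr0 => [|l li]; last first.
    rewrite mxE big1 ?mul0r // => a _.
    by rewrite mxE (negPf li) andbF mulr0.
  rewrite mxE (bigD1 k) //= big1 ?addr0 => [|l lk]; last first.
    by rewrite mxE (negPf lk) mulr0.
  by rewrite mxE !eqxx.
have [q [qp pq]] := Adiv _ p0.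
(* Multiplying by the inverse [q] on both sides shows that [A] is the line [F q]; as 1 lies on it,
   [A] consists of scalars. *)
have xE y : exists c : F, y = c *: q.
  have [c cE] := pE y; exists c.
  have := congr1 (fun z => q * z * q) cE.
  by rewrite !mulrA qp mul1r -mulrA pq mulr1 -scalerAr qp -scalerAl mul1r.
have [c cE] := xE 1; have [d dE] := xE x.
have c0 : c != 0.
  by apply/eqP => c0; have /eqP := cE; rewrite c0 scale0r oner_eq0.
by exists (d / c); rewrite cE scalerA mulfVK.
Qed.

Lemma bw_inv_plus (F : fieldType) (A : superAlgType F) :
  (forall x : A, exists c : F, x = c%:A) -> bw_inv A BWplus 1 F^o.
Proof.
move=> scalarA; have Acs := scalar_central_simple scalarA.
split; first exact: central_simple_superW.
split=> //; first exact: scalar_brauer_eq.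
left; split=> [x|]; last by exists 1; rewrite ?oner_neq0 // expr1n mulr1.
have [c ->] := scalarA x; have [_ pZ] := spart_semi A true.
by rewrite pZ -(@homog1 F A) spartK scaler0.
Qed.

(** Here [A] is [F + F u]. A nonzero graded ideal contains a nonzero scalar, either an even part [c]
    or the product of an odd part [d u] with [u], which is [d a]. Without the grading, [u] is
    central but not a scalar, so [A] is not central simple. *)
Lemma bw_inv_minus (F : fieldType) (A : superAlgType F) (u : A) (a : F) :
  (forall x : A, homog false x -> exists c : F, x = c%:A) ->
  (forall x : A, homog true x -> exists c : F, x = c *: u) ->
  homog true u -> u * u = a%:A -> a != 0 -> bw_inv A BWminus a F^o.
Proof.
move=> evenA oddA uo uu a0.
have u0 : u != 0.
  apply: contraNneq a0 => u0; have := esym uu; rewrite u0 mul0r => /eqP.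
  by rewrite scaler_eq0 oner_eq0 orbF.
have not_even x : homog true x -> homog false x -> x = 0.
  by move=> <- <-; rewrite spartK.
have u_central x : x * u = u * x.
  rewrite -(spart_sum x).
  have [c ->] := evenA _ (spart_homog false x).
  have [d ->] := oddA _ (spart_homog true x).
  by rewrite mulrDl mulrDr mulr_algl mulr_algr -scalerAl -scalerAr.
split; first split.
- exists [:: 1; u] => v; rewrite -(spart_sum v).
  have [c ->] := evenA _ (spart_homog false v).
  have [d ->] := oddA _ (spart_homog true v).
  exists (fun i => if i == 0%N then c else d).
  by rewrite !big_ord_recl big_ord0 addr0.
- by move=> z /evenA.
- move=> I [I0 ID IM] Ip.
  have scalarI (c : F) : c != 0 -> I c%:A -> forall x, I x.
    move=> c0 Ic x; have := IM (c^-1)%:A x _ Ic.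
    by rewrite mulr_algl scalerA mulVf // scale1r mul1r.
  case: (pselect (exists2 x, I x & x != 0)) => [[x Ix x0]|noI]; last first.
    by left=> x Ix; apply: contrapT => /eqP x0; apply: noI; exists x.
  right; have [c cE] := evenA _ (spart_homog false x).
  have [d dE] := oddA _ (spart_homog true x).
  have [c0|c0] := eqVneq c 0; last by apply: (scalarI c) => //; rewrite -cE; apply: Ip.
  have d0 : d != 0.
    by apply: contraNneq x0 => d0; rewrite -(spart_sum x) cE dE c0 d0 !scale0r addr0.
  apply: (scalarI (d * a)); first exact: mulf_neq0.
  have := IM 1 u _ (Ip true x Ix).
  by rewrite dE mul1r -scalerAl uu scalerA.
split.
- move=> [_ /(_ u) cen _]; have [|c uE] := cen.
    by move=> x; rewrite u_central.
  case/eqP: u0; apply: not_even => //; rewrite uE /homog.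
  by rewrite (proj2 (spart_semi A false)) homog1.
- apply: scalar_brauer_eq => x.
  have [c cE] := evenA _ (elimT (even_partP _) (valP x)).
  by exists c; apply: val_inj; rewrite linearZ.
- exists u, a; split=> //; last by exists 1; rewrite ?oner_neq0 // expr1n mul1r.
Qed.

(** * Endomorphisms of an irreducible representation *)

Section EndomorphismAlgebra.
Variables (F : fieldType) (A : hopfSuperType F) (V : irrep A).

Lemma scalar_EndG : (forall f : EndG V, exists c : F, f = c%:A) <->
  (forall f : V -> V, rep_hom f -> exists c : F, forall v, f v = c *: v).
Proof.
split=> [scal f fh|scal f].
  have [c cE] := scal (@Endo F V (EndG_closed V) f fh); exists c => v.
  exact: (congr1 (fun g : EndG V => g v) cE).
have [c cE] := scal f (efunP f); exists c; apply: endo_eq => v; exact: cE.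
Qed.

Lemma EndG_division (f : EndG V) : f != 0 -> exists g, g * f = 1 /\ f * g = 1.
Proof.
move=> f0; have fh : rep_hom f := efunP f.
have fv : exists v, f v != 0.
  apply: contrapT => nov; case/eqP: f0; apply: endo_eq => v.
  by apply: contrapT => /eqP fv; apply: nov; exists v.
have [g fK gK] := inj_surj_inverse (irreducible_hom_inj (irrP V) fh fv)
                                   (irreducible_hom_surj (irrP V) fh fv).
exists (@Endo F V (EndG_closed V) g (rep_hom_inv fh fK gK)).
by split; apply: endo_eq => v; [apply: fK | apply: gK].
Qed.

Lemma absolutely_irreducible_brauer :
  (forall f : EndG V, exists c : F, f = c%:A) ->
  absolutely_irreducible V /\ brauer_eq (EndG V) F^o.
Proof.
move=> EndV; split; last exact: scalar_brauer_eq.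
exact: scalar_end_absolutely_irreducible (irrP V) (scalar_EndG.1 EndV).
Qed.

(** A nonzero odd [u] is injective by Schur's lemma, so the scalar [a = u * u] is nonzero. For odd
    [x] the even product [x * u] is a scalar [c], whence [x = (c / a) u]. If there is no such [u],
    the superalgebra is [F]. *)
Lemma bw_inv_uEnd : (forall f : EndG V, exists c : F, f = c%:A) ->
  bw_inv (uEnd V) BWplus 1 F^o \/
  exists2 a : F, a != 0 & bw_inv (uEnd V) BWminus a F^o.
Proof.
move=> /scalar_EndG scal.
have even_scal (x : uEnd V) : homog false x -> exists c : F, x = c%:A.
  by move=> /uEnd_homogP/scal[c cE]; exists c; apply: endo_eq => v; apply: cE.
case: (pselect (exists2 u : uEnd V, homog true u & u != 0)) => [[u uo u0]|noodd].
  right; have uh := (uEnd_homogP true u).1 uo.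
  have uI : injective u.
    apply: (irreducible_hom_inj (irrP V) uh).
    apply: contrapT => nov; case/eqP: u0; apply: endo_eq => v.
    by apply: contrapT => /eqP fv; apply: nov; exists v.
  have [a uu] := even_scal _ (uEnd_homogM uo uo).
  have a0 : a != 0.
    apply: contraNneq u0 => a0; apply/eqP/endo_eq => v; apply: uI.
    have us := endo_semi u; rewrite [RHS](semi0 us).
    by have := congr1 (fun g : uEnd V => g v) uu; rewrite a0 scale0r.
  exists a => //; apply: (bw_inv_minus even_scal _ uo uu a0) => x xo.
  have [c cE] := even_scal _ (uEnd_homogM xo uo); exists (c / a).
  have := congr1 (fun y => a^-1 *: (y * u)) cE.
  rewrite -mulrA uu mulr_algl mulr_algr !scalerA mulVf // scale1r => ->.
  by rewrite mulrC.
left; apply: bw_inv_plus => x; apply: even_scal.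
rewrite -(spart_sum x) (_ : spart true x = 0) ?addr0; first exact: spart_homog.
apply: contrapT => /eqP x0; apply: noodd; exists (spart true x) => //.
exact: spart_homog.
Qed.

End EndomorphismAlgebra.

(** * Equivalence of the three conditions and the Brauer-Wall class *)

Theorem corollary4p11 (F Fs : fieldType) (j : {rmorphism F -> Fs})
    (A : hopfSuperType F) (V : rep (bc j A)) (VF : irrep A) :
  2%N \notin [pchar F] ->
  separable_closure j ->
  quasi_rational V ->
  rep_embeds V (rep_bc j VF) ->
  [/\ (exists W : rep A, rep_iso V (rep_bc j W)) <-> absolutely_irreducible VF,
      absolutely_irreducible VF <-> brauer_eq (EndG VF) F^o
    & (exists W : rep A, rep_iso V (rep_bc j W)) ->
      bw_inv (uEnd VF) BWplus 1 F^o \/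
      exists2 a : F, a != 0 & bw_inv (uEnd VF) BWminus a F^o].
Proof.
move=> _ _ [Virr [Vend _]] [i [ih iI]].
pose scal := forall f : EndG VF, exists c : F, f = c%:A.
have form_scal : (exists W : rep A, rep_iso V (rep_bc j W)) -> scal.
  move=> [W VW]; have Wend := scalar_end_descent Vend VW.
  have Wirr := irreducible_bc_descent (irreducible_iso Virr VW).
  have [p [ph [q pK qK]]] := VW.
  have [[w w0] _] := Wirr.
  (* The composite of [q] and [i] is nonzero at [1 (x) w] because both maps are injective. *)
  have [|g [gh gw]] := hom_descent (v := w) (rep_hom_comp (rep_hom_inv ph pK qK) ih).
    apply: contraNneq w0 => E; have [iL _ _] := ih.
    have q0 : q (bcin j w) = 0.
      by apply: iI; rewrite E (semi0 ((linear_semi i).1 iL)).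
    apply/eqP/(@bcin_inj _ _ j); rewrite -[LHS]qK q0.
    have [pL _ _] := ph.
    by rewrite (semi0 ((linear_semi p).1 pL)) (semi0 (bcin_semi j W)).
  have gI := irreducible_hom_inj Wirr gh (ex_intro _ w gw).
  have gS := irreducible_hom_surj (irrP VF) gh (ex_intro _ w gw).
  have [h gK hK] := inj_surj_inverse gI gS.
  (* Conjugation by the isomorphism [g] turns [f] into an endomorphism of [W]. *)
  apply/scalar_EndG => f fh.
  have [c cE] := Wend _ (rep_hom_comp (rep_hom_comp gh fh) (rep_hom_inv gh gK hK)).
  exists c => v; apply: (can_inj hK); rewrite -[v in LHS]hK cE.
  have [hL _ _] := rep_hom_inv gh gK hK.
  by rewrite (proj2 ((linear_semi h).1 hL)).
have abs_form : absolutely_irreducible VF -> exists W : rep A, rep_iso V (rep_bc j W).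
  (* Irreducibility over [Fs] makes the embedding [i] onto, so [VF] itself is the form. *)
  move=> /(_ Fs j) Kirr; exists VF, i; split=> //.
  have [[v v0] _] := Virr; have [iL _ _] := ih.
  have [|k iK kK] := inj_surj_inverse iI (irreducible_hom_surj Kirr ih _).
    exists v; apply: contraNneq v0 => iv; apply/eqP/iI.
    by rewrite iv (semi0 ((linear_semi i).1 iL)).
  by exists k.
have scal_abs (s : scal) := absolutely_irreducible_brauer s.
split; [split=> [/form_scal/scal_abs[]//|/abs_form//]|split|].
- by move=> /abs_form/form_scal/scal_abs[].
- by move=> /(division_brauer_trivial (@EndG_division F A VF))/scal_abs[].
- by move=> /form_scal/bw_inv_uEnd.
Qed.
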